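(* Let $a,b,c,d,x_0,x_1$ be nonzero real numbers such that $a,c<0$, $b,d>0$ and $x_0,x_1>1$. Then the piecewise system $$\begin{cases}\dot z=(a+ib)(z-i+x_1), & z\in\Sigma_+=\{\Im(z)>1\},\\ \dot z=\dfrac{i}{z}, & z\in\Sigma_c=\{|\Im(z)|<1\},\\ \dot z=(c+id)(z+i-x_0), & z\in\Sigma_-=\{\Im(z)<-1\},\end{cases}$$ has a limit cycle.
   Context: Planar piecewise-smooth system ($z=x+iy\in\mathbb C\cong\mathbb R^2$) with discontinuity lines $\Im(z)=\pm1$, on which the dynamics follows Filippov's convention (where both adjacent vector fields cross the line in the same direction, trajectories are obtained by concatenation). A limit cycle is an isolated periodic orbit. *)

(* Defs.v *)
From Stdlib Require Import Reals.
From Coquelicot Require Export Coquelicot.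

Local Open Scope R_scope.

(** Lebesgue-null subsets of the line, through outer measure. *)
Definition null_set (E : R -> Prop) : Prop :=
  forall eps : R, 0 < eps ->
  exists u v : nat -> R,
    (forall n, u n <= v n) /\
    (forall n, sum_n (fun k => v k - u k) n <= eps) /\
    (forall t, E t -> exists n, u n < t < v n).

Definition almost_every (P : R -> Prop) : Prop := null_set (fun t => ~ P t).

(** The finite family of non-overlapping intervals [[u k, v k]], [k <= n], is
    listed from left to right. *)
Definition absolutely_continuous (z : R -> C) (s t : R) : Prop :=
  forall eps : R, 0 < eps ->
  exists delta : R, 0 < delta /\
  forall (n : nat) (u v : nat -> R),
    (forall k, (k <= n)%nat -> s <= u k /\ u k <= v k /\ v k <= t) ->
    (forall k, (k < n)%nat -> v k <= u (S k)) ->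
    sum_n (fun k => v k - u k) n < delta ->
    sum_n (fun k => Cmod (z (v k) - z (u k))%C) n < eps.

Definition segment (p q w : C) : Prop :=
  exists l : R, 0 <= l <= 1 /\ w = (RtoC l * p + RtoC (1 - l) * q)%C.

(** Filippov's set-valued field of the system equal to [fp] on [Im z > 1], [fc]
    on [|Im z| < 1] and [fm] on [Im z < -1], where the three formulas make sense
    and are continuous up to the lines on the phase space [D].  On a line it is
    the convex hull of the two one-sided limits; this yields concatenation at
    crossing points and the sliding vector field elsewhere.  [D] removes the
    singularities of the formulas, at which [/ 0 = 0] would otherwise produce a
    spurious value. *)
Definition filippov (D : C -> Prop) (fp fc fm : C -> C) (z w : C) : Prop :=
  D z /\
  ((1 < Im z /\ w = fp z) \/
   (Im z = 1 /\ segment (fp z) (fc z) w) \/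
   (Rabs (Im z) < 1 /\ w = fc z) \/
   (Im z = -1 /\ segment (fc z) (fm z) w) \/
   (Im z < -1 /\ w = fm z)).

(** Complete solutions of [z' ∈ F z] (all [t] in [R]).  The first clause keeps
    the solution in the domain of [F] at every time, not only at almost every
    time. *)
Definition solution (F : C -> C -> Prop) (z : R -> C) : Prop :=
  (forall t, exists w, F (z t) w) /\
  (forall s t, s <= t -> absolutely_continuous z s t) /\
  almost_every
    (fun t => exists w, is_derive (V := C_R_NormedModule) z t w /\ F (z t) w).

Definition periodic_orbit (F : C -> C -> Prop) (G : C -> Prop) : Prop :=
  exists (z : R -> C) (T : R),
    solution F z /\ 0 < T /\ (forall t, z (t + T) = z t) /\
    (exists s t, z s <> z t) /\
    (forall p, G p <-> exists t, z t = p).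

(** A periodic orbit with a neighbourhood that contains no other one. *)
Definition limit_cycle (F : C -> C -> Prop) (G : C -> Prop) : Prop :=
  periodic_orbit F G /\
  exists U : C -> Prop,
    open U /\ (forall p, G p -> U p) /\
    forall G' : C -> Prop,
      periodic_orbit F G' -> (forall p, G' p -> U p) ->
      forall p, G' p <-> G p.

(* Main.v *)
(* In each zone the orbits are explicit: logarithmic spirals about the foci
   [-x1 + i] and [x0 - i], which lie on the discontinuity lines, and, since
   [(z^2)' = 2i], hyperbolas in the central strip.  Hence the return map on
   [Im z = 1] is an affine contraction, whose fixed point gives the cycle.  The
   signed deviation [L] of an orbit from the cycle satisfies [L' = a L], [L' = 0]
   or [L' = c L] in the three zones, so [L^2] is nonincreasing and must vanish on
   every periodic orbit avoiding the Z-shaped arc through the foci and the origin;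
   forward uniqueness then identifies that orbit with the cycle.

   Filippov solutions are only absolutely continuous, but a Lipschitz function of
   such a solution is monotone as soon as its derivative is nonnegative almost
   everywhere.  This makes solutions classical off the lines, and [Im z] strictly
   monotone near a crossing, so that crossing times are isolated. *)

Require Import Defs.
From Stdlib Require Import Reals Arith Cantor Lra Lia Classical.
From Coquelicot Require Import Coquelicot.

Local Open Scope R_scope.

(** * Monotonicity along absolutely continuous curves *)

(** The Z-shaped arc collects what the argument cannot cross. On its horizontal segments the two
    adjacent fields point away from the line, so a solution may leave a sliding motion at any time
    and forward uniqueness fails. Across its vertical segment run the hyperbolas with
    [Re (z^2) < 0], along which the deviation would jump from one of its strip formulas to the
    other. Off the arc every contact with a line is a transversal crossing. A return map would need
    return times for an arbitrary periodic solution. The deviation does without them: on each ray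
    where two of its formulas meet, both reduce to [|Re z|] minus the value of [|Re z|] on the
    cycle, so it is continuous along solutions, and comparing it just before and just after each
    instant is enough. Decay is strict only in the half-planes; a periodic solution confined to the
    closed strip is excluded separately, because [Re z * Im z] grows there at unit speed. The bounds
    [x0, x1 > 1] force [X, Y > 1], so the hyperbolas of the cycle have [Re (z^2) > 0] and stay off
    the imaginary axis. *)

Lemma real_induction (P : R -> Prop) (s t : R) :
  s <= t -> P s ->
  (forall x, s <= x < t -> P x ->
     exists eta, 0 < eta /\ forall y, x <= y < x + eta -> y <= t -> P y) ->
  (forall x, s < x <= t -> (forall y, s <= y < x -> P y) -> P x) ->
  P t.
Proof.
intros Hst Ps Hr Hl.
set (E := fun x => s <= x <= t /\ forall y, s <= y <= x -> P y).
assert (Es : E s).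
{ split; [lra|]. intros y Hy. replace y with s by lra. exact Ps. }
destruct (completeness E) as [m [Hub Hlub]].
- exists t. intros x [Hx _]; lra.
- exists s; exact Es.
- assert (Hsm : s <= m) by (apply Hub; exact Es).
  assert (Hmt : m <= t) by (apply Hlub; intros x [Hx _]; lra).
  assert (Hbelow : forall y, s <= y < m -> P y).
  { intros y Hy. apply NNPP; intro nP.
    assert (m <= y); [|lra].
    apply Hlub. intros x [Hx HP]. destruct (Rle_or_lt x y); [assumption|].
    exfalso; apply nP, HP; lra. }
  assert (Pm : P m).
  { destruct (Req_dec s m) as [<-|]; [exact Ps|].
    apply Hl; [lra|]. exact Hbelow. }
  destruct (Req_dec m t) as [<-|Hne]; [exact Pm|].
  destruct (Hr m) as [eta [He HP]]; [lra|exact Pm|].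
  set (q := Rmin (m + eta / 2) t).
  assert (q <= m).
  { apply Hub. unfold E, q. split.
    - unfold Rmin; destruct Rle_dec; lra.
    - intros y Hy. destruct (Rlt_or_le y m).
      + apply Hbelow; lra.
      + apply HP; revert Hy; unfold Rmin; destruct Rle_dec; lra. }
  revert H; unfold q, Rmin; destruct Rle_dec; lra.
Qed.

(** Real induction: the comparison to the right of [x] gives the forward step, the one to the left
    gives the limit step. No continuity or derivative enters at [x], which may therefore be a point
    where two smooth pieces meet. *)
Lemma local_monotone (f : R -> R) :
  (forall x, exists eta, 0 < eta /\
     (forall y, x <= y < x + eta -> f y <= f x) /\
     (forall y, x - eta < y <= x -> f x <= f y)) ->
  forall s t, s <= t -> f t <= f s.
Proof.
intros H s t Hst.
apply (real_induction (fun x => f x <= f s) s t Hst); [lra| |].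
- intros x Hx Hfx. destruct (H x) as [eta [He [Hr _]]].
  exists eta; split; [assumption|]. intros y Hy _. specialize (Hr y Hy); lra.
- intros x Hx IH. destruct (H x) as [eta [He [_ Hl]]].
  set (y := Rmax s (x - eta / 2)).
  assert (s <= y < x /\ x - eta < y <= x) as [Hy1 Hy2].
  { unfold y, Rmax; destruct Rle_dec; lra. }
  specialize (IH y Hy1). specialize (Hl y Hy2). lra.
Qed.

Lemma is_derive_Re (z : R -> C) (t : R) (w : C) :
  is_derive (V := C_R_NormedModule) z t w ->
  is_derive (fun s => Re (z s)) t (Re w).
Proof.
intros H.
apply (filterdiff_comp' (U := R_NormedModule) (V := C_R_NormedModule) (W := R_NormedModule) z fst t
  (fun y : R => scal y w) fst H).
apply (filterdiff_linear (U := C_R_NormedModule) (V := R_NormedModule)), is_linear_fst.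
Qed.

Lemma is_derive_Im (z : R -> C) (t : R) (w : C) :
  is_derive (V := C_R_NormedModule) z t w ->
  is_derive (fun s => Im (z s)) t (Im w).
Proof.
intros H.
apply (filterdiff_comp' (U := R_NormedModule) (V := C_R_NormedModule) (W := R_NormedModule) z snd t
  (fun y : R => scal y w) snd H).
apply (filterdiff_linear (U := C_R_NormedModule) (V := R_NormedModule)), is_linear_snd.
Qed.

Lemma is_derive_pair (z : R -> C) (t : R) (w : C) :
  is_derive (fun s => Re (z s)) t (Re w) ->
  is_derive (fun s => Im (z s)) t (Im w) ->
  is_derive (V := C_R_NormedModule) z t w.
Proof.
intros H1 H2.
assert (H := filterdiff_comp'_2 (K := R_AbsRing) (U := R_NormedModule) (V := R_NormedModule)
  (W := C_R_NormedModule)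
  (fun s => Re (z s)) (fun s => Im (z s)) (fun x y => (x, y)) t _ _ (fun x y => (x,y)) H1 H2).
assert (Hid : filterdiff
  (fun t : prod_NormedModule R_AbsRing R_NormedModule R_NormedModule => (fst t, snd t) : C_R_NormedModule)
  (locally (Re (z t), Im (z t)))
  (fun t : prod_NormedModule R_AbsRing R_NormedModule R_NormedModule => (fst t, snd t) : C_R_NormedModule)).
{ apply (filterdiff_ext_lin (U := C_R_NormedModule) (V := C_R_NormedModule) _ (fun x => x)).
  - apply (filterdiff_ext (U := C_R_NormedModule) (V := C_R_NormedModule) (fun x => x));
      [|apply filterdiff_id].
    intros [x y]; reflexivity.
  - intros [x y]; reflexivity. }
specialize (H Hid).
apply (filterdiff_ext_lin (U := R_NormedModule) (V := C_R_NormedModule) _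
  (fun y : R => (scal y (Re w), scal y (Im w)))).
- apply (filterdiff_ext (U := R_NormedModule) (V := C_R_NormedModule) (fun y => (Re (z y), Im (z y)))).
  + intros y. destruct (z y); reflexivity.
  + exact H.
- intros y. destruct w; reflexivity.
Qed.

Lemma is_derive_slope (f : R -> R) (x l eps : R) :
  is_derive f x l -> 0 < eps ->
  exists eta, 0 < eta /\
    forall y, Rabs (y - x) < eta -> Rabs (f y - f x - l * (y - x)) <= eps * Rabs (y - x).
Proof.
intros H He. apply is_derive_Reals in H.
destruct (H eps He) as [d Hd]. exists d; split; [apply cond_pos|].
intros y Hy. destruct (Req_dec (y - x) 0) as [E|E].
- replace y with x by lra. replace (f x - f x - l * (x - x)) with 0 by ring.
  rewrite Rabs_R0. apply Rmult_le_pos; [lra|apply Rabs_pos].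
- specialize (Hd (y - x) E Hy). replace (x + (y - x)) with y in Hd by ring.
  replace (f y - f x - l * (y - x)) with (((f y - f x) / (y - x) - l) * (y - x)) by (field; lra).
  rewrite Rabs_mult. apply Rmult_le_compat_r; [apply Rabs_pos|lra].
Qed.

Definition clamp (u v x : R) : R := Rmin v (Rmax u x).

Lemma clamp_incr u v x y : x <= y -> clamp u v x <= clamp u v y.
Proof. unfold clamp, Rmin, Rmax. repeat destruct Rle_dec; lra. Qed.

Lemma clamp_width u v x y : u <= v -> clamp u v y - clamp u v x <= v - u.
Proof. unfold clamp, Rmin, Rmax. repeat destruct Rle_dec; lra. Qed.

Lemma clamp_id u v x : u <= x <= v -> clamp u v x = x.
Proof. unfold clamp, Rmin, Rmax. repeat destruct Rle_dec; lra. Qed.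

Lemma sum_n_nonneg (a : nat -> R) (n : nat) :
  (forall k, 0 <= a k) -> 0 <= sum_n a n.
Proof.
intros H. induction n as [|n IH]; [rewrite sum_O; apply H|].
rewrite sum_Sn. unfold plus; simpl. specialize (H (S n)). lra.
Qed.

Lemma sum_n_le_compat (a b : nat -> R) (n : nat) :
  (forall k, (k <= n)%nat -> a k <= b k) -> sum_n a n <= sum_n b n.
Proof.
intros H. induction n as [|n IH]; [rewrite !sum_O; apply H; lia|].
rewrite !sum_Sn. unfold plus; simpl. specialize (H (S n) (le_n _)) as H'.
assert (sum_n a n <= sum_n b n) by (apply IH; intros; apply H; lia). lra.
Qed.

Lemma sum_n_incr (a : nat -> R) (n m : nat) :
  (forall k, 0 <= a k) -> (n <= m)%nat -> sum_n a n <= sum_n a m.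
Proof.
intros H Hnm. induction Hnm as [|m Hnm IH]; [lra|].
rewrite sum_Sn. unfold plus; simpl. specialize (H (S m)). lra.
Qed.

Lemma sum_n_ge_term (a : nat -> R) (k n : nat) :
  (forall k, 0 <= a k) -> (k <= n)%nat -> a k <= sum_n a n.
Proof.
intros H Hkn. apply Rle_trans with (sum_n a k); [|apply sum_n_incr; assumption].
destruct k; [rewrite sum_O; lra|]. rewrite sum_Sn. unfold plus; simpl.
pose proof (sum_n_nonneg a k H). lra.
Qed.

Lemma sum_n_Rminus (a b : nat -> R) (n : nat) :
  sum_n (fun k => a k - b k) n = sum_n a n - sum_n b n.
Proof.
induction n as [|n IH]; [now rewrite !sum_O|].
rewrite !sum_Sn, IH. unfold plus; simpl. ring.
Qed.

Lemma sum_n_append (a : nat -> R) (y : R) (n : nat) :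
  sum_n (fun k => if le_dec k n then a k else y) (S n) = sum_n a n + y.
Proof.
rewrite sum_Sn. unfold plus; simpl. f_equal.
- apply sum_n_ext_loc. intros k Hk. destruct le_dec; [reflexivity|lia].
- destruct le_dec; [lia|reflexivity].
Qed.

(* The points where the derivative fails are covered by open intervals of small
   total length; [clamp] measures how much of that length has been used up to
   [x], which bounds the lengths of the non-overlapping intervals on which only
   absolute continuity is available. *)
Lemma absolutely_continuous_monotone (z : R -> C) (f : R -> R) (K s t : R) :
  s <= t -> 0 <= K -> absolutely_continuous z s t ->
  (forall x y, s <= x -> x <= y -> y <= t ->
     Rabs (f y - f x) <= K * (Cmod (z y - z x)%C + (y - x))) ->
  almost_every (fun x => s <= x <= t -> exists l, is_derive f x l /\ 0 <= l) ->
  f s <= f t.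
Proof.
intros Hst HK Hac Hdom Hae.
assert (Hkey : forall eps, 0 < eps -> f s - f t <= eps * (t - s) + K * (eps + eps)).
2:{ apply le_epsilon. intros e He.
    assert (Hp : 0 < e / (t - s + 2 * K + 1)) by (apply Rdiv_lt_0_compat; lra).
    specialize (Hkey _ Hp).
    assert (e / (t - s + 2 * K + 1) * (t - s + 2 * K) <= e).
    { apply Rmult_le_reg_r with (t - s + 2 * K + 1); [lra|]. field_simplify; [nra|lra]. }
    nra. }
intros eps Heps.
destruct (Hac eps Heps) as [del [Hdel Hfam]].
(* The bound lies below [del], so that absolute continuity will apply to the collected intervals,
   and below [eps], which controls their lengths themselves. *)
destruct (Hae (Rmin del eps / 2)) as [U [V [HUV [Hlen Hcov]]]].
{ assert (0 < Rmin del eps) by (apply Rmin_glb_lt; assumption). lra. }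
set (m := fun N x => sum_n (fun j => clamp (U j) (V j) x - clamp (U j) (V j) s) N).
(* The family collects the steps made inside covering intervals. Its length is charged to the part
   [m N x] of the cover lying between [s] and [x], hence never exceeds the total length of the
   cover; all other steps cost at most [eps] times their length. *)
set (P := fun x => exists (n : nat) (u v : nat -> R) (N : nat),
  (forall k, (k <= n)%nat -> s <= u k /\ u k <= v k /\ v k <= x) /\
  (forall k, (k < n)%nat -> v k <= u (S k)) /\
  sum_n (fun k => v k - u k) n <= m N x /\
  f s - f x <= eps * (x - s) +
     sum_n (fun k => K * (Cmod (z (v k) - z (u k))%C + (v k - u k))) n).
set (good := fun x y => f x - f y <= eps * (y - x) \/ exists j, U j <= x /\ y <= V j).
assert (Hstep : forall x y, s <= x -> x <= y -> y <= t -> P x -> good x y -> P y).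
{ intros x y Hsx Hxy Hyt [n [u [v [N [H1 [H2 [H3 H4]]]]]]] Hg.
  assert (Hm : forall N, m N x <= m N y).
  { intros M. apply sum_n_le_compat. intros k _.
    pose proof (clamp_incr (U k) (V k) x y Hxy). lra. }
  destruct Hg as [Hg|[j [Hj1 Hj2]]].
  - exists n, u, v, N. repeat split; try (intros; apply H1 || apply H2; assumption).
    + destruct (H1 k H) as [? [? ?]]; lra.
    + specialize (Hm N); lra.
    + lra.
  (* The interval from [x] to [y] joins the family. Reading the cover up to [max N j] makes sure
     that its [j]-th interval, which contains the new one, pays for it. *)
  - exists (S n), (fun k => if le_dec k n then u k else x),
      (fun k => if le_dec k n then v k else y), (max N j).
    assert (Hn : 0 <= sum_n (fun k => v k - u k) n).
    { clear - H1. induction n as [|n IH].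
      - rewrite sum_O. destruct (H1 0%nat) as [? [? ?]]; [lia|lra].
      - rewrite sum_Sn. unfold plus; simpl. destruct (H1 (S n)) as [? [? ?]]; [lia|].
        assert (0 <= sum_n (fun k => v k - u k) n) by (apply IH; intros; apply H1; lia). lra. }
    split; [|split; [|split]].
    + intros k Hk. destruct (le_dec k n) as [l|l]; [|lra].
      destruct (H1 k l) as [? [? ?]]; lra.
    + intros k Hk. destruct (le_dec k n) as [l|l]; [|lia].
      destruct (le_dec (S k) n) as [l'|l']; [apply H2; lia|].
      apply (H1 k l).
    + replace (sum_n _ (S n)) with (sum_n (fun k => v k - u k) n + (y - x)).
      2:{ rewrite <- sum_n_append. apply sum_n_ext. intros k. destruct le_dec; reflexivity. }
      assert (HN : m N x <= m (max N j) x).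
      { apply sum_n_incr; [|lia]. intros k. pose proof (clamp_incr (U k) (V k) s x Hsx). lra. }
      assert (y - x <= m (max N j) y - m (max N j) x); [|lra].
      set (c := fun k => clamp (U k) (V k) y - clamp (U k) (V k) x).
      replace (m (max N j) y - m (max N j) x) with (sum_n c (max N j)).
      2:{ unfold m, c. rewrite <- sum_n_Rminus. apply sum_n_ext. intros k; simpl; ring. }
      replace (y - x) with (c j).
      2:{ unfold c. rewrite !clamp_id; lra. }
      apply sum_n_ge_term; [|lia]. intros k. unfold c.
      pose proof (clamp_incr (U k) (V k) x y Hxy). lra.
    + replace (sum_n _ (S n)) with
        (sum_n (fun k => K * (Cmod (z (v k) - z (u k))%C + (v k - u k))) n
         + K * (Cmod (z y - z x)%C + (y - x))).
      2:{ rewrite <- sum_n_append. apply sum_n_ext. intros k. destruct le_dec; reflexivity. }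
      specialize (Hdom x y Hsx Hxy Hyt). apply Rabs_le_between in Hdom. nra. }
assert (Hloc : forall x, s <= x <= t -> exists eta, 0 < eta /\
   (forall y, x <= y < x + eta -> good x y) /\ (forall y, x - eta < y <= x -> good y x)).
{ intros x Hx.
  destruct (classic (exists l, is_derive f x l /\ 0 <= l)) as [[l [Hl Hl0]]|Hn].
  - destruct (is_derive_slope f x l eps Hl Heps) as [eta [He H]].
    exists eta; split; [assumption|]. split; intros y Hy; left.
    + assert (Ha : Rabs (y - x) < eta) by (rewrite Rabs_pos_eq; lra).
      specialize (H y Ha). rewrite (Rabs_pos_eq (y - x)) in H by lra.
      apply Rabs_le_between in H. nra.
    + assert (Ha : Rabs (y - x) < eta) by (rewrite Rabs_left1; lra).
      specialize (H y Ha). rewrite (Rabs_left1 (y - x)) in H by lra.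
      apply Rabs_le_between in H. nra.
  - destruct (Hcov x) as [j Hj]; [intros HH; apply Hn, HH, Hx|].
    exists (Rmin (x - U j) (V j - x)). split; [apply Rmin_glb_lt; lra|].
    split; intros y Hy; right; exists j; revert Hy; unfold Rmin; destruct Rle_dec; lra. }
assert (HP : P t).
{ apply (real_induction P s t Hst).
  - exists 0%nat, (fun _ => s), (fun _ => s), 0%nat. split; [intros; lra|].
    split; [intros; lra|]. unfold m. rewrite !sum_O. split; [lra|].
    replace (z s - z s)%C with (RtoC 0) by ring. rewrite Cmod_0. lra.
  - intros x Hx Px. destruct (Hloc x) as [eta [He [Hr _]]]; [lra|].
    exists eta; split; [assumption|]. intros y Hy Hyt.
    apply (Hstep x y); try lra; [assumption|]. apply Hr; assumption.
  - intros x Hx IH. destruct (Hloc x) as [eta [He [_ Hl]]]; [lra|].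
    set (y := Rmax s (x - eta / 2)).
    assert (s <= y < x /\ x - eta < y <= x) as [Hy1 Hy2].
    { unfold y, Rmax; destruct Rle_dec; lra. }
    apply (Hstep y x); try lra; [apply IH; lra|]. apply Hl; assumption. }
destruct HP as [n [u [v [N [H1 [H2 [H3 H4]]]]]]].
assert (HmN : m N t <= Rmin del eps / 2).
{ eapply Rle_trans; [|apply (Hlen N)]. apply sum_n_le_compat.
  intros k _. apply clamp_width, HUV. }
assert (Hmin : Rmin del eps <= del /\ Rmin del eps <= eps /\ 0 < Rmin del eps).
{ split; [apply Rmin_l|split; [apply Rmin_r|apply Rmin_glb_lt; assumption]]. }
assert (Hsum := Hfam n u v H1 H2 ltac:(lra)).
assert (sum_n (fun k => K * (Cmod (z (v k) - z (u k))%C + (v k - u k))) n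
  = K * (sum_n (fun k => Cmod (z (v k) - z (u k))%C) n + sum_n (fun k => v k - u k) n)).
{ clear. induction n as [|n IH]; [rewrite !sum_O; lra|].
  rewrite !sum_Sn. unfold plus; simpl. rewrite IH. lra. }
nra.
Qed.

(** * Solutions of differential inclusions *)

Lemma locally_interval (x : R) (P : R -> Prop) :
  locally x P -> exists eta, 0 < eta /\ forall y, Rabs (y - x) < eta -> P y.
Proof.
intros [eps H]. exists eps; split; [apply cond_pos|]. intros y Hy. apply H, Hy.
Qed.

Lemma slope_is_derive (f : R -> R) (x l : R) :
  (forall eps, 0 < eps -> exists eta, 0 < eta /\
    forall y, Rabs (y - x) < eta -> Rabs (f y - f x - l * (y - x)) <= eps * Rabs (y - x)) ->
  is_derive f x l.
Proof.
intros H. apply is_derive_Reals. intros eps He.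
destruct (H (eps / 2)) as [eta [Heta Hy]]; [lra|].
exists (mkposreal eta Heta). intros h Hh0 Hh. simpl in Hh.
specialize (Hy (x + h)). replace (x + h - x) with h in Hy by ring.
specialize (Hy Hh).
replace ((f (x + h) - f x) / h - l) with ((f (x + h) - f x - l * h) / h) by (field; assumption).
rewrite Rabs_div by assumption.
assert (0 < Rabs h) by (apply Rabs_pos_lt; assumption).
apply Rmult_lt_reg_r with (Rabs h); [assumption|].
unfold Rdiv. rewrite Rmult_assoc, Rinv_l by lra. nra.
Qed.

Lemma almost_every_impl (P Q : R -> Prop) :
  (forall t, P t -> Q t) -> almost_every P -> almost_every Q.
Proof.
intros HPQ HP eps He. destruct (HP eps He) as [u [v [H1 [H2 H3]]]].
exists u, v; repeat split; try assumption. intros t Ht. apply H3.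
intros Pt; apply Ht, HPQ, Pt.
Qed.

Lemma im_le_Cmod (z : C) : Rabs (Im z) <= Cmod z.
Proof. eapply Rle_trans; [apply Rmax_r|apply Rmax_Cmod]. Qed.

Lemma solution_continuous F w t : solution F w -> continuous (w : R -> C) t.
Proof.
intros [_ [Hac _]] P [eps HP].
destruct (Hac (t - 1) (t + 1) ltac:(lra) eps (cond_pos eps)) as [del [Hd H]].
assert (Hm : 0 < Rmin del 1) by (apply Rmin_glb_lt; lra).
exists (mkposreal _ Hm). intros y Hy. apply HP.
change (Rabs (y - t) < Rmin del 1) in Hy.
assert (Hd1 : Rmin del 1 <= del) by apply Rmin_l.
assert (Hd2 : Rmin del 1 <= 1) by apply Rmin_r.
apply Rabs_def2 in Hy.
assert (Hc : Cmod (w y - w t)%C < eps).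
{ destruct (Rle_or_lt t y).
  - specialize (H 0%nat (fun _ => t) (fun _ => y)). rewrite !sum_O in H.
    apply H; intros; try lia; lra.
  - specialize (H 0%nat (fun _ => y) (fun _ => t)). rewrite !sum_O in H.
    rewrite <- Cmod_opp. replace (- (w y - w t))%C with (w t - w y)%C by ring.
    apply H; intros; try lia; lra. }
pose proof (re_le_Cmod (w y - w t)%C) as Hre. pose proof (im_le_Cmod (w y - w t)%C) as Him.
split; [change (Rabs (Re (w y - w t)%C) < eps)|change (Rabs (Im (w y - w t)%C) < eps)]; lra.
Qed.

(** The linear form minus [m * s] has a nonnegative derivative at almost every time near [t]. All
    use of the almost-everywhere clause passes through this bound: it yields differentiability where
    [F] is single-valued and transversality where all values of [F] have a common vertical
    direction. *)
Lemma solution_rate F w t (al be m : R) :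
  solution F w ->
  locally (w t) (fun p => forall v, F p v -> m <= al * Re v + be * Im v) ->
  exists eta, 0 < eta /\ forall x y, t - eta < x -> x <= y -> y < t + eta ->
    m * (y - x) <= (al * Re (w y) + be * Im (w y)) - (al * Re (w x) + be * Im (w x)).
Proof.
intros Hsol Hloc.
destruct (locally_interval t _ (solution_continuous F w t Hsol _ Hloc)) as [eta [He H]].
exists eta; split; [assumption|]. intros x y Hx Hxy Hy.
destruct Hsol as [_ [Hac Hae]].
set (f := fun s => al * Re (w s) + be * Im (w s) - m * s).
assert (Hf : f x <= f y); [|unfold f in Hf; lra].
apply (absolutely_continuous_monotone w f (Rabs al + Rabs be + Rabs m) x y Hxy).
- pose proof (Rabs_pos al); pose proof (Rabs_pos be); pose proof (Rabs_pos m); lra.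
- apply Hac, Hxy.
- intros p q _ Hpq _. unfold f.
  replace (al * Re (w q) + be * Im (w q) - m * q - (al * Re (w p) + be * Im (w p) - m * p))
    with (al * Re (w q - w p)%C + be * Im (w q - w p)%C + - m * (q - p))
    by (unfold Re, Im, Cminus, Cplus, Copp; simpl; ring).
  pose proof (re_le_Cmod (w q - w p)%C) as Hre. pose proof (im_le_Cmod (w q - w p)%C) as Him.
  pose proof (Rabs_pos al); pose proof (Rabs_pos be); pose proof (Rabs_pos m).
  pose proof (Cmod_ge_0 (w q - w p)%C).
  eapply Rle_trans; [apply Rabs_triang|].
  eapply Rle_trans; [apply Rplus_le_compat_r, Rabs_triang|].
  rewrite !Rabs_mult, Rabs_Ropp, (Rabs_pos_eq (q - p)) by lra.
  assert (Rabs al * Rabs (Re (w q - w p)%C) <= Rabs al * Cmod (w q - w p)%C)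
    by (apply Rmult_le_compat_l; assumption).
  assert (Rabs be * Rabs (Im (w q - w p)%C) <= Rabs be * Cmod (w q - w p)%C)
    by (apply Rmult_le_compat_l; assumption).
  nra.
- revert Hae. apply almost_every_impl. intros s [v [Hv HFv]] Hs.
  exists (al * Re v + be * Im v - m). split.
  + unfold f. pose proof (is_derive_Re _ _ _ Hv) as HR. pose proof (is_derive_Im _ _ _ Hv) as HI.
    evar_last.
    * apply @is_derive_minus; [apply @is_derive_plus; apply is_derive_scal; eassumption|].
      apply is_derive_scal, @is_derive_id.
    * unfold minus, plus, opp, scal, one; simpl. unfold mult; simpl. ring.
  + assert (Hs' : Rabs (s - t) < eta) by (apply Rabs_def1; lra).
    specialize (H s Hs' v HFv). lra.
Qed.

(** By continuity of [f], every linear form increases at least at its rate at [w t] minus [eps]; the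
    opposite form gives the upper bound. The forms [Re] and [Im] then give the two components of the
    derivative. *)
Lemma solution_interior F (f : C -> C) w t :
  solution F w -> locally (w t) (fun p => forall v, F p v -> v = f p) ->
  continuous f (w t) ->
  is_derive (V := C_R_NormedModule) w t (f (w t)).
Proof.
intros Hsol HF Hf.
assert (Hgen : forall al be eps, 0 < eps -> exists eta, 0 < eta /\
  forall y, Rabs (y - t) < eta ->
    let g p := al * Re p + be * Im p in
    Rabs (g (w y) - g (w t) - g (f (w t)) * (y - t)) <= eps * Rabs (y - t)).
{ intros al be eps Heps.
  assert (Hsgn : forall a' b', exists eta, 0 < eta /\ forall x y,
    t - eta < x -> x <= y -> y < t + eta ->
    (a' * Re (f (w t)) + b' * Im (f (w t)) - eps) * (y - x)
     <= (a' * Re (w y) + b' * Im (w y)) - (a' * Re (w x) + b' * Im (w x))).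
  { intros a' b'. apply (solution_rate F w t); [assumption|].
    set (K := Rabs a' + Rabs b' + 1).
    assert (HK : 0 < K) by (unfold K; pose proof (Rabs_pos a'); pose proof (Rabs_pos b'); lra).
    assert (Hq : 0 < eps / K) by (apply Rdiv_lt_0_compat; assumption).
    assert (Hb := Hf _ (locally_ball (f (w t)) (mkposreal _ Hq))).
    generalize (filter_and _ _ HF Hb). apply filter_imp.
    intros p [Hp [Hp1 Hp2]] v Hv. rewrite (Hp v Hv). simpl in Hp1, Hp2.
    change (Rabs (Re (f p) - Re (f (w t))) < eps / K) in Hp1.
    change (Rabs (Im (f p) - Im (f (w t))) < eps / K) in Hp2.
    assert (Habs : Rabs (a' * (Re (f p) - Re (f (w t))) + b' * (Im (f p) - Im (f (w t)))) <= eps).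
    { eapply Rle_trans; [apply Rabs_triang|]. rewrite !Rabs_mult.
      assert (eps = K * (eps / K)) by (field; lra).
      pose proof (Rabs_pos a'); pose proof (Rabs_pos b').
      unfold K in *. set (q := eps / (Rabs a' + Rabs b' + 1)) in *. nra. }
    apply Rabs_le_between in Habs. lra. }
  destruct (Hsgn al be) as [e1 [He1 H1]]. destruct (Hsgn (- al) (- be)) as [e2 [He2 H2]].
  exists (Rmin e1 e2). split; [apply Rmin_glb_lt; assumption|].
  intros y Hy g. unfold g; clear g.
  assert (Hm1 : Rmin e1 e2 <= e1) by apply Rmin_l.
  assert (Hm2 : Rmin e1 e2 <= e2) by apply Rmin_r.
  apply Rabs_def2 in Hy. apply Rabs_le.
  destruct (Rle_or_lt t y).
  - specialize (H1 t y ltac:(lra) ltac:(lra) ltac:(lra)).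
    specialize (H2 t y ltac:(lra) ltac:(lra) ltac:(lra)).
    rewrite Rabs_pos_eq by lra. lra.
  - specialize (H1 y t ltac:(lra) ltac:(lra) ltac:(lra)).
    specialize (H2 y t ltac:(lra) ltac:(lra) ltac:(lra)).
    rewrite Rabs_left1 by lra. lra. }
apply is_derive_pair; apply slope_is_derive; intros eps Heps.
- destruct (Hgen 1 0 eps Heps) as [eta [He H]]. exists eta; split; [assumption|].
  intros y Hy. specialize (H y Hy). simpl in H.
  match type of H with Rabs ?a <= _ =>
    match goal with |- Rabs ?b <= _ => replace b with a by (simpl; ring) end end.
  exact H.
- destruct (Hgen 0 1 eps Heps) as [eta [He H]]. exists eta; split; [assumption|].
  intros y Hy. specialize (H y Hy). simpl in H.
  match type of H with Rabs ?a <= _ =>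
    match goal with |- Rabs ?b <= _ => replace b with a by (simpl; ring) end end.
  exact H.
Qed.

Lemma nonincreasing_of_derive (f : R -> R) (x y : R) :
  x <= y -> (forall s, x <= s <= y -> continuous f s) ->
  (forall s, x < s < y -> exists l, is_derive f s l /\ l <= 0) -> f y <= f x.
Proof.
intros Hxy Hc Hd.
(* The intermediate point lies in the closed interval, whereas the sign of the derivative is known
   only inside; truncation by [Rmin 0] makes the value nonpositive at the endpoints as well. *)
destruct (MVT_gen f x y (fun s => Rmin 0 (Derive f s))) as [c [_ Hm]].
- rewrite Rmin_left, Rmax_right by assumption. intros s Hs.
  destruct (Hd s Hs) as [l [Hl Hl0]]. rewrite (is_derive_unique _ _ _ Hl).
  rewrite Rmin_right; assumption.
- rewrite Rmin_left, Rmax_right by assumption. intros s Hs.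
  apply continuity_pt_filterlim, Hc, Hs.
- pose proof (Rmin_l 0 (Derive f c)). nra.
Qed.

Lemma constant_of_derive (f : R -> R) (x y : R) :
  x <= y -> (forall s, x <= s <= y -> continuous f s) ->
  (forall s, x < s < y -> is_derive f s 0) -> f y = f x.
Proof.
intros Hxy Hc Hd. apply Rle_antisym.
- apply nonincreasing_of_derive; try assumption.
  intros s Hs. exists 0; split; [apply Hd, Hs|lra].
- enough (- f y <= - f x) by lra.
  apply (nonincreasing_of_derive (fun s => - f s)); [assumption| |].
  + intros s Hs. apply (continuous_opp (V := R_NormedModule)), Hc, Hs.
  + intros s Hs. exists 0; split; [|lra].
    evar_last; [apply @is_derive_opp, Hd, Hs|]. apply Ropp_0.
Qed.

Lemma periodic_nat {A : Type} (f : R -> A) (T : R) :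
  (forall t, f (t + T) = f t) -> forall n t, f (t + INR n * T) = f t.
Proof.
intros H n. induction n as [|n IH]; intros t.
- simpl. f_equal. ring.
- rewrite S_INR. replace (t + (INR n + 1) * T) with (t + INR n * T + T) by ring.
  rewrite H. apply IH.
Qed.

Lemma exists_period_above (T s t : R) : 0 < T -> exists n, t <= s + INR n * T.
Proof.
intros HT. destruct (INR_unbounded ((t - s) / T)) as [n Hn]. exists n.
apply Rmult_lt_compat_r with (r := T) in Hn; [|assumption].
unfold Rdiv in Hn. rewrite Rmult_assoc, Rinv_l in Hn by lra. lra.
Qed.

(** Adding periods carries [s] beyond [t] without changing [f s], so monotonicity compares the two
    values in either order. *)
Lemma periodic_nonincreasing (f : R -> R) (T : R) :
  0 < T -> (forall t, f (t + T) = f t) -> (forall s t, s <= t -> f t <= f s) ->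
  forall s t, f s = f t.
Proof.
intros HT Hp Hm.
assert (H : forall s t, f s <= f t).
{ intros s t. destruct (exists_period_above T s t HT) as [n Hn].
  rewrite <- (periodic_nat f T Hp n s). apply Hm, Hn. }
intros s t. apply Rle_antisym; apply H.
Qed.

Lemma constant_is_derive (f : R -> R) (t l : R) :
  (forall s, f s = f t) -> is_derive f t l -> l = 0.
Proof.
intros Hc Hl. rewrite <- (is_derive_unique _ _ _ Hl).
rewrite (Derive_ext f (fun _ => f t)) by (intros; apply Hc). apply Derive_const.
Qed.

Lemma lipschitz_absolutely_continuous (z : R -> C) (M s t : R) :
  (forall x y, x <= y -> Cmod (z y - z x)%C <= M * (y - x)) -> absolutely_continuous z s t.
Proof.
intros HM eps He.
assert (HM0 : 0 <= M).
{ specialize (HM 0 1 ltac:(lra)). pose proof (Cmod_ge_0 (z 1 - z 0)%C). lra. }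
exists (eps / (M + 1)). split; [apply Rdiv_lt_0_compat; lra|].
intros n u v H1 _ Hs.
apply Rle_lt_trans with (sum_n (fun k => M * (v k - u k)) n).
{ apply sum_n_le_compat. intros k Hk. apply HM, (H1 k Hk). }
replace (sum_n (fun k => M * (v k - u k)) n) with (M * sum_n (fun k => v k - u k) n).
2:{ symmetry. apply (sum_n_mult_l (K := R_AbsRing) M (fun k => v k - u k) n). }
apply Rle_lt_trans with (M * (eps / (M + 1))); [apply Rmult_le_compat_l; lra|].
apply Rmult_lt_reg_r with (M + 1); [lra|].
replace (M * (eps / (M + 1)) * (M + 1)) with (M * eps) by (field; lra). lra.
Qed.

Lemma countable_null_set (E : R -> Prop) (e : nat -> R) :
  (forall t, E t -> exists n, t = e n) -> null_set E.
Proof.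
intros HE eps He.
assert (Hq : forall n, 0 < (1 / 2) ^ n) by (intros; apply pow_lt; lra).
(* The interval around [e n] has length [eps / 2 ^ (n + 1)], and these lengths sum to [eps]. *)
exists (fun n => e n - eps / 4 * (1 / 2) ^ n), (fun n => e n + eps / 4 * (1 / 2) ^ n).
split; [|split].
- intros n. specialize (Hq n). nra.
- intros n.
  assert (Hsum : sum_n (fun k => e k + eps / 4 * (1 / 2) ^ k - (e k - eps / 4 * (1 / 2) ^ k)) n
    = eps * (1 - (1 / 2) ^ S n)).
  { induction n as [|n IH].
    - rewrite sum_O. simpl. field.
    - rewrite sum_Sn, IH. unfold plus; simpl. field. }
  rewrite Hsum. specialize (Hq (S n)). nra.
- intros t Ht. destruct (HE t Ht) as [n ->]. exists n. specialize (Hq n). nra.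
Qed.

(** * Explicit orbits: spirals and hyperbolas *)

(* Polar angle, in [[0, PI]], on the closed upper half-plane minus the origin: the
   half-angle formula is smooth up to the whole boundary. *)
Definition angle (u v : R) : R := PI / 2 - 2 * atan (u / (sqrt (u ^ 2 + v ^ 2) + v)).

(** Radial excess over the orbit of [z' = (a + i b) z] that leaves the positive axis at radius [r0].
    Unlike the first integral [r e^(-(a/b) theta)], it is affine with slope of modulus one on each
    half-axis, so it matches the strip formulas without rescaling. *)
Definition spiral (a b r0 u v : R) : R :=
  sqrt (u ^ 2 + v ^ 2) - r0 * exp (a / b * angle u v).

Lemma radius_pos u v : u <> 0 \/ 0 < v -> 0 < u ^ 2 + v ^ 2.
Proof. intros [H|H]; nra. Qed.

Lemma radius_plus_pos u v : 0 <= v -> u <> 0 \/ 0 < v -> 0 < sqrt (u ^ 2 + v ^ 2) + v.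
Proof. intros Hv H. pose proof (sqrt_lt_R0 _ (radius_pos u v H)). lra. Qed.

Lemma sqr_sqrt_radius u v : sqrt (u ^ 2 + v ^ 2) ^ 2 = u ^ 2 + v ^ 2.
Proof. rewrite <- Rsqr_pow2. apply Rsqr_sqrt. nra. Qed.

Lemma spiral_pos_axis a b r0 u : 0 < u -> spiral a b r0 u 0 = u - r0.
Proof.
intros Hu. unfold spiral, angle. replace (u ^ 2 + 0 ^ 2) with (u ^ 2) by ring.
rewrite sqrt_pow2 by lra. replace (u / (u + 0)) with 1 by (field; lra).
rewrite atan_1. replace (PI / 2 - 2 * (PI / 4)) with 0 by field.
rewrite Rmult_0_r, exp_0. ring.
Qed.

Lemma spiral_neg_axis a b r0 u : u < 0 -> spiral a b r0 u 0 = - u - r0 * exp (a / b * PI).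
Proof.
intros Hu. unfold spiral, angle. replace (u ^ 2 + 0 ^ 2) with ((- u) ^ 2) by ring.
rewrite sqrt_pow2 by lra. replace (u / (- u + 0)) with (- (1)) by (field; lra).
rewrite atan_opp, atan_1. replace (PI / 2 - 2 * - (PI / 4)) with PI by field.
reflexivity.
Qed.

(** Both terms grow at rate [a]: the radius directly, and the exponential because the angle turns at
    speed [b], which cancels the division by [b]. *)
Lemma spiral_derive a b r0 (u v : R -> R) (t : R) :
  b <> 0 -> 0 < v t ->
  is_derive u t (a * u t - b * v t) -> is_derive v t (b * u t + a * v t) ->
  is_derive (fun s => spiral a b r0 (u s) (v s)) t (a * spiral a b r0 (u t) (v t)).
Proof.
intros Hb Hv Hu' Hv'.
assert (Hr2 : 0 < u t ^ 2 + v t ^ 2) by nra.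
set (r := fun s => sqrt (u s ^ 2 + v s ^ 2)).
assert (Hr0 : 0 < r t) by (apply sqrt_lt_R0; assumption).
assert (Hrr : r t ^ 2 = u t ^ 2 + v t ^ 2) by apply sqr_sqrt_radius.
assert (Hr : is_derive r t (a * r t)).
{ assert (Hs : is_derive (fun s => u s ^ 2 + v s ^ 2) t (2 * a * r t ^ 2)).
  { evar_last; [apply @is_derive_plus; apply is_derive_pow; eassumption|].
    rewrite Hrr. unfold plus; simpl. ring. }
  evar_last; [apply (is_derive_sqrt _ _ _ Hs Hr2)|].
  change (2 * a * r t ^ 2 / (2 * r t) = a * r t). field. lra. }
set (q := fun s => u s / (r s + v s)).
assert (Hq : is_derive q t (- b * r t / (r t + v t))).
{ unfold q. evar_last.
  - apply is_derive_div; [exact Hu'| |lra]. apply @is_derive_plus; eassumption.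
  - unfold plus; simpl. apply Rmult_eq_reg_r with ((r t + v t) ^ 2); [|nra].
    transitivity (- b * (r t * v t + v t ^ 2 + u t ^ 2)).
    + field. lra.
    + transitivity (- b * r t * (r t + v t)); [nra|field; lra]. }
assert (Ha : is_derive (fun s => angle (u s) (v s)) t b).
{ unfold angle. evar_last.
  - apply @is_derive_minus; [apply @is_derive_const|].
    apply is_derive_scal. apply (is_derive_comp atan q); [apply is_derive_atan|exact Hq].
  - unfold minus, plus, opp, scal, zero; simpl. unfold mult, q, Rsqr; simpl.
    assert (E : 1 + u t / (r t + v t) * (u t / (r t + v t)) = 2 * r t / (r t + v t)).
    { apply Rmult_eq_reg_r with ((r t + v t) ^ 2); [|nra]. field_simplify; [|lra|lra]. nra. }
    rewrite E. field. split; lra. }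
unfold spiral. evar_last.
- apply @is_derive_minus; [exact Hr|]. apply is_derive_scal.
  apply (is_derive_comp exp); [apply is_derive_exp|]. apply is_derive_scal, Ha.
- change (a * r t - r0 * (a / b * b * exp (a / b * angle (u t) (v t)))
    = a * (r t - r0 * exp (a / b * angle (u t) (v t)))). field. exact Hb.
Qed.

(** [q] is the tangent of half the complementary angle, so cosine and sine become [2 q / (1 + q^2)]
    and [(1 - q^2) / (1 + q^2)], where [1 + q^2 = 2 r / (r + v)]. *)
Lemma cos_sin_angle u v : 0 <= v -> u <> 0 \/ 0 < v ->
  sqrt (u ^ 2 + v ^ 2) * cos (angle u v) = u /\ sqrt (u ^ 2 + v ^ 2) * sin (angle u v) = v.
Proof.
intros Hv H. pose proof (radius_pos u v H) as Hr2. pose proof (sqrt_lt_R0 _ Hr2) as Hr.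
pose proof (sqr_sqrt_radius u v) as Hrr.
unfold angle. set (r := sqrt (u ^ 2 + v ^ 2)) in *. set (q := u / (r + v)).
rewrite cos_shift, sin_shift, sin_2a, cos_2a, sin_atan, cos_atan.
assert (E : 1 + q² = 2 * r / (r + v)).
{ unfold q, Rsqr. apply Rmult_eq_reg_r with ((r + v) ^ 2); [|nra].
  field_simplify; [|lra|lra]. nra. }
assert (Hs : 0 < 1 + q²) by (pose proof (Rle_0_sqr q); lra).
pose proof (sqrt_lt_R0 _ Hs) as Hs0.
assert (Es : sqrt (1 + q²) * sqrt (1 + q²) = 1 + q²) by (apply sqrt_sqrt; lra).
set (s := sqrt (1 + q²)) in *.
split.
- replace (2 * (q / s) * (1 / s)) with (2 * q / (s * s)) by (field; lra).
  rewrite Es, E. unfold q. field. lra.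
- replace (1 / s * (1 / s) - q / s * (q / s)) with ((1 - q * q) / (s * s)) by (field; lra).
  rewrite Es, E. unfold q. transitivity (((r + v) ^ 2 - u ^ 2) / (2 * (r + v))); [field; lra|].
  replace (u ^ 2) with (r ^ 2 - v ^ 2) by lra. field. lra.
Qed.

Lemma angle_range u v : 0 <= v -> u <> 0 \/ 0 < v -> 0 <= angle u v <= PI.
Proof.
intros Hv H. pose proof (radius_plus_pos u v Hv H) as Hp.
pose proof (sqr_sqrt_radius u v) as Hrr. pose proof (sqrt_pos (u ^ 2 + v ^ 2)) as Hr.
unfold angle. set (r := sqrt (u ^ 2 + v ^ 2)) in *. set (q := u / (r + v)).
assert (Hq : -1 <= q <= 1).
{ split; apply Rmult_le_reg_r with (r + v); try assumption; unfold q; field_simplify; try lra; nra. }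
assert (Hmon : forall x y, x <= y -> atan x <= atan y).
{ intros x y [Hxy| ->]; [left; apply atan_increasing, Hxy|right; reflexivity]. }
pose proof (Hmon q 1 (proj2 Hq)) as H1. pose proof (Hmon (-1) q (proj1 Hq)) as H2.
replace (-1) with (- (1)) in H2 by ring. rewrite atan_opp in H2. rewrite atan_1 in H1, H2. lra.
Qed.

(** * Continuity of the explicit formulas *)

Lemma continuous_pair_C {T : UniformSpace} (f : T -> C) (x : T) :
  continuous (fun y => Re (f y)) x -> continuous (fun y => Im (f y)) x -> continuous f x.
Proof.
intros H1 H2 P [eps HP]. unfold filtermap.
assert (B1 : locally x (fun y => ball (Re (f x)) eps (Re (f y)))) by exact (H1 _ (locally_ball _ eps)).
assert (B2 : locally x (fun y => ball (Im (f x)) eps (Im (f y)))) by exact (H2 _ (locally_ball _ eps)).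
generalize (filter_and _ _ B1 B2). apply filter_imp.
intros y [Hy1 Hy2]. apply HP. split; assumption.
Qed.

Lemma continuous_Re (z : C) : continuous Re z.
Proof. destruct z. apply continuous_fst. Qed.

Lemma continuous_Im (z : C) : continuous Im z.
Proof. destruct z. apply continuous_snd. Qed.

Lemma continuous_Rplus {T : UniformSpace} (f g : T -> R) (x : T) :
  continuous f x -> continuous g x -> continuous (fun y => f y + g y) x.
Proof. apply (continuous_plus (V := R_NormedModule)). Qed.

Lemma continuous_Rminus {T : UniformSpace} (f g : T -> R) (x : T) :
  continuous f x -> continuous g x -> continuous (fun y => f y - g y) x.
Proof. apply (continuous_minus (V := R_NormedModule)). Qed.

Lemma continuous_Rmult {T : UniformSpace} (f g : T -> R) (x : T) :
  continuous f x -> continuous g x -> continuous (fun y => f y * g y) x.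
Proof. apply (continuous_mult (K := R_AbsRing)). Qed.

Lemma continuous_sqr {T : UniformSpace} (f : T -> R) (x : T) :
  continuous f x -> continuous (fun y => f y ^ 2) x.
Proof.
intros H. apply (continuous_ext (fun y => f y * f y)); [intros; simpl; ring|].
apply continuous_Rmult; assumption.
Qed.

Ltac cont := repeat (first [assumption | apply continuous_const |
  lazymatch goal with
  | |- continuous (fun y => Re y) _ => apply continuous_Re
  | |- continuous Re _ => apply continuous_Re
  | |- continuous Im _ => apply continuous_Im
  | |- continuous (fun y => _ + _) _ => apply continuous_Rplus
  | |- continuous (fun y => _ - _) _ => apply continuous_Rminus
  | |- continuous (fun y => _ * _) _ => apply continuous_Rmult
  | |- continuous (fun y => _ ^ 2) _ => apply continuous_sqr
  end]).

(** Valid up to [v = 0] on both half-axes, since [r + v] stays positive there and only the focus is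
    excluded; this carries the deviation through a crossing. *)
Lemma spiral_continuous {T : UniformSpace} a b r0 (u v : T -> R) (x : T) :
  0 <= v x -> u x <> 0 \/ 0 < v x ->
  continuous u x -> continuous v x -> continuous (fun y => spiral a b r0 (u y) (v y)) x.
Proof.
intros Hv H Cu Cv. pose proof (radius_plus_pos _ _ Hv H) as Hp.
assert (Cr : continuous (fun y => sqrt (u y ^ 2 + v y ^ 2)) x).
{ apply (continuous_comp (fun y => u y ^ 2 + v y ^ 2) sqrt); [cont|apply continuous_sqrt]. }
assert (Ca : continuous (fun y => angle (u y) (v y)) x).
{ unfold angle, Rdiv. apply continuous_Rminus; [apply continuous_const|].
  apply continuous_Rmult; [apply continuous_const|].
  apply (continuous_comp (fun y => u y * / (sqrt (u y ^ 2 + v y ^ 2) + v y)) atan);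
    [|apply continuous_atan].
  apply continuous_Rmult; [assumption|].
  apply (continuous_comp (fun y => sqrt (u y ^ 2 + v y ^ 2) + v y) Rinv);
    [|apply continuous_Rinv; lra].
  apply continuous_Rplus; assumption. }
unfold spiral. apply continuous_Rminus; [assumption|].
apply continuous_Rmult; [apply continuous_const|].
apply (continuous_comp (fun y => a / b * angle (u y) (v y)) exp); [|apply continuous_exp].
apply continuous_Rmult; [apply continuous_const|assumption].
Qed.

Lemma locally_gt {T : UniformSpace} (f : T -> R) (x : T) (m : R) :
  continuous f x -> m < f x -> locally x (fun y => m < f y).
Proof.
intros Hf H. exact (Hf (fun y => m < y) (open_gt m (f x) H)).
Qed.

Lemma locally_lt {T : UniformSpace} (f : T -> R) (x : T) (m : R) :
  continuous f x -> f x < m -> locally x (fun y => f y < m).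
Proof.
intros Hf H. exact (Hf (fun y => y < m) (open_lt m (f x) H)).
Qed.

Lemma segment_Im p q v m sg :
  segment p q v -> m <= sg * Im p -> m <= sg * Im q -> m <= sg * Im v.
Proof.
intros [l [Hl ->]] Hp Hq.
replace (Im (RtoC l * p + RtoC (1 - l) * q)%C) with (l * Im p + (1 - l) * Im q)
  by (unfold Im; simpl; ring).
nra.
Qed.

Lemma shift_derive (w : R -> C) tau s v :
  is_derive (V := C_R_NormedModule) w (tau + s) v ->
  is_derive (V := C_R_NormedModule) (fun r => w (tau + r)) s v.
Proof.
intros H.
assert (Hs : is_derive (fun r => tau + r) s 1).
{ evar_last; [apply @is_derive_plus; [apply @is_derive_const|apply @is_derive_id]|]. apply Rplus_0_l. }
evar_last; [apply (is_derive_comp (V := C_R_NormedModule) w _ s); [exact H|exact Hs]|].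
exact (scal_one (V := C_R_NormedModule) v).
Qed.

Lemma shift_continuous (w : R -> C) tau s :
  continuous w (tau + s) -> continuous (fun r => w (tau + r)) s.
Proof.
intros H. apply (continuous_comp (fun r => tau + r) w); [|exact H].
apply continuous_Rplus; [apply continuous_const|apply continuous_id].
Qed.

Definition rot_re (e f r s : R) : R := r * exp (e * s) * cos (f * s).

Definition rot_im (e f r s : R) : R := r * exp (e * s) * sin (f * s).

Lemma rot_derive e f r s :
  is_derive (rot_re e f r) s (e * rot_re e f r s - f * rot_im e f r s) /\
  is_derive (rot_im e f r) s (f * rot_re e f r s + e * rot_im e f r s).
Proof. unfold rot_re, rot_im. split; auto_derive; trivial; ring. Qed.

(** The two equations say [z^2 = w^2] for [z = p + i q] and [w = r + i s]. From
    [|z - w|^2 |z + w|^2 = |z^2 - w^2|^2] follows [z = w] or [z = - w], and the sign of the real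
    parts excludes the latter. *)
Lemma square_root_unique (p q r s : R) :
  0 < p * r -> p ^ 2 - q ^ 2 = r ^ 2 - s ^ 2 -> p * q = r * s -> p = r /\ q = s.
Proof.
intros Hpr H1 H2.
assert (E : ((p - r) ^ 2 + (q - s) ^ 2) * ((p + r) ^ 2 + (q + s) ^ 2) = 0).
{ transitivity ((p ^ 2 - q ^ 2 - (r ^ 2 - s ^ 2)) ^ 2 + (2 * (p * q - r * s)) ^ 2); [ring|].
  rewrite H1, H2. ring. }
apply Rmult_integral in E.
destruct E as [E|E]; rewrite <- !Rsqr_pow2 in E; apply Rplus_sqr_eq_0 in E; [lra|nra].
Qed.

(* Square root of [m^2 - 1 + 2 i s]; on [Im = 1] it passes through [m + i] at [s = m]. *)
Definition hyp_re (m s : R) : R := sqrt ((sqrt ((m ^ 2 - 1) ^ 2 + 4 * s ^ 2) + (m ^ 2 - 1)) / 2).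

Definition hyp_im (m s : R) : R := s / hyp_re m s.

Lemma hyp_spec m s : 1 < m ->
  0 < hyp_re m s /\ hyp_re m s ^ 2 - hyp_im m s ^ 2 = m ^ 2 - 1 /\ hyp_re m s * hyp_im m s = s /\
  hyp_re m s ^ 2 + hyp_im m s ^ 2 = sqrt ((m ^ 2 - 1) ^ 2 + 4 * s ^ 2).
Proof.
intros Hm. assert (Hk : 0 < m ^ 2 - 1) by nra.
set (rho := sqrt ((m ^ 2 - 1) ^ 2 + 4 * s ^ 2)).
assert (Hr : rho ^ 2 = (m ^ 2 - 1) ^ 2 + 4 * s ^ 2).
{ unfold rho. rewrite <- Rsqr_pow2. apply Rsqr_sqrt. nra. }
assert (Hr0 : 0 <= rho) by apply sqrt_pos.
assert (Hx0 : 0 < hyp_re m s) by (apply sqrt_lt_R0; fold rho; lra).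
assert (Hx : hyp_re m s ^ 2 = (rho + (m ^ 2 - 1)) / 2).
{ unfold hyp_re. fold rho. rewrite <- Rsqr_pow2. apply Rsqr_sqrt. lra. }
assert (Hxy : hyp_re m s * hyp_im m s = s) by (unfold hyp_im; field; lra).
assert (Hy : hyp_im m s ^ 2 = (rho - (m ^ 2 - 1)) / 2).
{ apply Rmult_eq_reg_l with (hyp_re m s ^ 2); [|nra].
  transitivity ((hyp_re m s * hyp_im m s) ^ 2); [ring|].
  rewrite Hxy, Hx. transitivity ((rho ^ 2 - (m ^ 2 - 1) ^ 2) / 4); [rewrite Hr; field|field]. }
repeat split; [assumption|rewrite Hx, Hy; field|assumption|rewrite Hx, Hy; field].
Qed.

Lemma hyp_unique m x y : 1 < m -> 0 < x -> x ^ 2 - y ^ 2 = m ^ 2 - 1 ->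
  hyp_re m (x * y) = x /\ hyp_im m (x * y) = y.
Proof.
intros Hm Hx H. destruct (hyp_spec m (x * y) Hm) as [H1 [H2 [H3 _]]].
apply square_root_unique; [nra|lra|assumption].
Qed.

(** If the imaginary part had modulus at least 1, the real part would be at least [m], and so would
    the modulus of their product [s]. The branch thus stays in the open strip between its two
    corners. *)
Lemma hyp_im_bound m s : 1 < m -> - m < s < m -> -1 < hyp_im m s < 1.
Proof.
intros Hm Hs. destruct (hyp_spec m s Hm) as [H1 [H2 [H3 _]]].
assert (hyp_im m s ^ 2 < 1); [|nra].
apply Rnot_le_lt. intros Hy.
assert (m ^ 2 <= hyp_re m s ^ 2) by lra.
assert (m ^ 2 <= s ^ 2); [|nra].
rewrite <- H3. rewrite Rpow_mult_distr. nra.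
Qed.

(** The right-hand sides are the components of [i / z = (y + i x) / |z|^2]: the parameter [s] is the
    time of the central field. *)
Lemma hyp_derive m s : 1 < m ->
  is_derive (hyp_re m) s (hyp_im m s * / (hyp_re m s ^ 2 + hyp_im m s ^ 2)) /\
  is_derive (hyp_im m) s (hyp_re m s * / (hyp_re m s ^ 2 + hyp_im m s ^ 2)).
Proof.
intros Hm. assert (Hk : 0 < m ^ 2 - 1) by nra.
destruct (hyp_spec m s Hm) as [H1 [H2 [H3 H4]]].
set (rho := fun s => sqrt ((m ^ 2 - 1) ^ 2 + 4 * s ^ 2)).
change (hyp_re m s ^ 2 + hyp_im m s ^ 2 = rho s) in H4.
assert (Hrho : 0 < rho s) by nra.
assert (D1 : is_derive rho s (4 * s / rho s)).
{ assert (D : is_derive (fun s => (m ^ 2 - 1) ^ 2 + 4 * s ^ 2) s (8 * s)).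
  { evar_last; [apply @is_derive_plus; [apply @is_derive_const|]|].
    - apply is_derive_scal, is_derive_pow, @is_derive_id.
    - unfold plus, zero, one; simpl. ring. }
  evar_last; [apply (is_derive_sqrt _ _ _ D); nra|].
  change (8 * s / (2 * rho s) = 4 * s / rho s). field. lra. }
assert (D2 : is_derive (hyp_re m) s (hyp_im m s * / rho s)).
{ assert (D : is_derive (fun s => (rho s + (m ^ 2 - 1)) / 2) s (2 * s / rho s)).
  { apply (is_derive_ext (fun s => / 2 * (rho s + (m ^ 2 - 1)))); [intros; simpl; field|].
    evar_last; [apply is_derive_scal, @is_derive_plus; [exact D1|apply @is_derive_const]|].
    unfold plus, zero; simpl. field. lra. }
  evar_last; [apply (is_derive_sqrt _ _ _ D); lra|].
  change (2 * s / rho s / (2 * hyp_re m s) = s / hyp_re m s * / rho s). field. lra. }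
rewrite H4. split; [exact D2|].
unfold hyp_im. evar_last; [apply is_derive_div; [apply @is_derive_id|exact D2|lra]|].
change ((1 * hyp_re m s - (s * (hyp_im m s * / rho s))) / hyp_re m s ^ 2 = hyp_re m s * / rho s).
assert (E : forall h y r, 0 < h -> 0 < r -> h ^ 2 + y ^ 2 = r ->
  (1 * h - h * y * (y * / r)) / h ^ 2 = h * / r).
{ intros h y r Hh Hr <-. field. lra. }
rewrite <- (E _ _ _ H1 Hrho H4), H3. reflexivity.
Qed.

Lemma exp_neg_pos (p q : R) : p < 0 -> 0 < q -> 0 < exp (p / q * PI) < 1.
Proof.
intros Hp Hq. split; [apply exp_pos|]. rewrite <- exp_0. apply exp_increasing.
assert (0 < / q) by (apply Rinv_0_lt_compat; assumption).
pose proof PI_RGT_0. assert (p * / q < 0) by nra. unfold Rdiv. nra.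
Qed.

(** * Crossing the discontinuity lines *)

(** The two half-planes and the two halves of the strip, in the order in which the cycle runs
    through them. *)
Inductive side : Set := Up | Lf | Dn | Rt.

Section System.

Context (a b c d x0 x1 : R) (a_neg : a < 0) (c_neg : c < 0) (b_pos : 0 < b) (d_pos : 0 < d)
  (x0_gt1 : 1 < x0) (x1_gt1 : 1 < x1).

Definition f_up (z : C) : C := ((RtoC a + Ci * RtoC b) * (z - Ci + RtoC x1))%C.
Definition f_ce (z : C) : C := (Ci / z)%C.
Definition f_dn (z : C) : C := ((RtoC c + Ci * RtoC d) * (z + Ci - RtoC x0))%C.

Definition F : C -> C -> Prop := filippov (fun z : C => z <> RtoC 0) f_up f_ce f_dn.

Definition field (k : side) : C -> C :=
  match k with Up => f_up | Dn => f_dn | _ => f_ce end.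

Lemma Re_up z : Re (f_up z) = a * (Re z + x1) - b * (Im z - 1).
Proof. unfold f_up, Re, Im. simpl. ring. Qed.
Lemma Im_up z : Im (f_up z) = b * (Re z + x1) + a * (Im z - 1).
Proof. unfold f_up, Re, Im. simpl. ring. Qed.
Lemma Re_dn z : Re (f_dn z) = c * (Re z - x0) - d * (Im z + 1).
Proof. unfold f_dn, Re, Im. simpl. ring. Qed.
Lemma Im_dn z : Im (f_dn z) = d * (Re z - x0) + c * (Im z + 1).
Proof. unfold f_dn, Re, Im. simpl. ring. Qed.
Lemma Re_ce z : Re (f_ce z) = Im z * / (Re z ^ 2 + Im z ^ 2).
Proof. unfold f_ce, Re, Im. simpl. unfold Rdiv. ring. Qed.
Lemma Im_ce z : Im (f_ce z) = Re z * / (Re z ^ 2 + Im z ^ 2).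
Proof. unfold f_ce, Re, Im. simpl. unfold Rdiv. ring. Qed.

Definition region (k : side) (z : C) : Prop :=
  match k with
  | Up => 1 < Im z
  | Lf => Re z < 0 /\ -1 < Im z < 1
  | Dn => Im z < -1
  | Rt => 0 < Re z /\ -1 < Im z < 1
  end.

(* The complement of the Z-shaped arc formed by the segments from [-x1 + i] to
   [i], from [i] to [-i] and from [-i] to [x0 - i]. *)
Definition annulus (z : C) : Prop :=
  (0 < Re z /\ -1 < Im z) \/ (Re z < 0 /\ Im z < 1) \/
  1 < Im z \/ Im z < -1 \/ x0 < Re z \/ Re z < - x1.

(** On a line the vertical speeds decide: [b (x + x1)] and [x / (x^2 + 1)] on [Im z = 1],
    [d (x - x0)] and [x / (x^2 + 1)] on [Im z = -1]. They share a strict sign exactly on the part of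
    the line lying in [annulus], and this sign tells which side is entered and, for [before], which
    one is left. *)
Definition after (k : side) (z : C) : Prop :=
  match k with
  | Up => 1 < Im z \/ (Im z = 1 /\ 0 < Re z)
  | Lf => Re z < 0 /\ -1 < Im z <= 1 /\ (Im z = 1 -> Re z < - x1)
  | Dn => Im z < -1 \/ (Im z = -1 /\ Re z < 0)
  | Rt => 0 < Re z /\ -1 <= Im z < 1 /\ (Im z = -1 -> x0 < Re z)
  end.

Definition before (k : side) (z : C) : Prop :=
  match k with
  | Up => 1 < Im z \/ (Im z = 1 /\ Re z < - x1)
  | Lf => Re z < 0 /\ -1 <= Im z < 1
  | Dn => Im z < -1 \/ (Im z = -1 /\ x0 < Re z)
  | Rt => 0 < Re z /\ -1 < Im z <= 1
  end.

Lemma annulus_after z : annulus z -> exists k, after k z.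
Proof.
intros H. unfold annulus in H.
destruct (Rtotal_order (Im z) 1) as [H1|[H1|H1]].
- destruct (Rtotal_order (Im z) (-1)) as [H2|[H2|H2]].
  + exists Dn; simpl; lra.
  + destruct (Rlt_or_le (Re z) 0); [exists Dn|exists Rt]; simpl; lra.
  + destruct (Rlt_or_le (Re z) 0); [exists Lf|exists Rt]; simpl; lra.
- destruct (Rlt_or_le 0 (Re z)); [exists Up|exists Lf]; simpl; lra.
- exists Up; simpl; lra.
Qed.

Lemma annulus_before z : annulus z -> exists k, before k z.
Proof.
intros H. unfold annulus in H.
destruct (Rtotal_order (Im z) 1) as [H1|[H1|H1]].
- destruct (Rtotal_order (Im z) (-1)) as [H2|[H2|H2]].
  + exists Dn; simpl; lra.
  + destruct (Rlt_or_le (Re z) 0); [exists Lf|exists Dn]; simpl; lra.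
  + destruct (Rlt_or_le (Re z) 0); [exists Lf|exists Rt]; simpl; lra.
- destruct (Rlt_or_le 0 (Re z)); [exists Rt|exists Up]; simpl; lra.
- exists Up; simpl; lra.
Qed.

Lemma open_annulus : open annulus.
Proof.
repeat first [apply open_or | apply open_and];
  try (intros z; apply (locally_gt Re), continuous_Re);
  try (intros z; apply (locally_lt Re), continuous_Re);
  try (intros z; apply (locally_gt Im), continuous_Im);
  try (intros z; apply (locally_lt Im), continuous_Im).
Qed.

Lemma open_region k : open (region k).
Proof.
destruct k; repeat apply open_and;
  try (intros z; apply (locally_gt Re), continuous_Re);
  try (intros z; apply (locally_lt Re), continuous_Re);
  try (intros z; apply (locally_gt Im), continuous_Im);
  try (intros z; apply (locally_lt Im), continuous_Im).
Qed.

Lemma f_up_continuous z : continuous f_up z.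
Proof.
apply continuous_pair_C.
- eapply continuous_ext; [intros y; symmetry; apply Re_up|]. cont.
- eapply continuous_ext; [intros y; symmetry; apply Im_up|]. cont.
Qed.

Lemma f_dn_continuous z : continuous f_dn z.
Proof.
apply continuous_pair_C.
- eapply continuous_ext; [intros y; symmetry; apply Re_dn|]. cont.
- eapply continuous_ext; [intros y; symmetry; apply Im_dn|]. cont.
Qed.

Lemma f_ce_continuous z : Re z <> 0 -> continuous f_ce z.
Proof.
intros Hz.
assert (Hi : continuous (fun y : C => / (Re y ^ 2 + Im y ^ 2)) z).
{ apply (continuous_comp (fun y : C => Re y ^ 2 + Im y ^ 2) Rinv); [cont|].
  apply continuous_Rinv. nra. }
apply continuous_pair_C.
- eapply continuous_ext; [intros y; symmetry; apply Re_ce|]. cont.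
- eapply continuous_ext; [intros y; symmetry; apply Im_ce|]. cont.
Qed.

Lemma field_continuous k z : region k z -> continuous (field k) z.
Proof.
destruct k; simpl; intros H;
  [apply f_up_continuous|apply f_ce_continuous; lra|apply f_dn_continuous|apply f_ce_continuous; lra].
Qed.

Lemma F_region k z v : region k z -> F z v -> v = field k z.
Proof.
intros Hk [_ HF].
destruct HF as [[H ->]|[[H _]|[[H ->]|[[H _]|[H ->]]]]]; destruct k; simpl in *;
  try reflexivity; try (apply Rabs_def2 in H); lra.
Qed.

Lemma solution_region w t k :
  solution F w -> region k (w t) -> is_derive (V := C_R_NormedModule) w t (field k (w t)).
Proof.
intros Hsol Hk. apply (solution_interior F); [assumption| |apply field_continuous, Hk].
generalize (open_region k (w t) Hk). apply filter_imp.
intros p Hp v. apply F_region, Hp.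
Qed.

(** If both fields have vertical speed of sign [sg], so have all their convex combinations, with a
    common lower bound [m] near [w t]. Sliding is thereby excluded, and [Im] is compared strictly
    with its value at [t] on both sides. *)
Lemma cross_rate w t (f g : C -> C) (sg : R) :
  solution F w -> sg ^ 2 = 1 ->
  locally (w t) (fun p => forall v, F p v -> v = f p \/ v = g p \/ segment (f p) (g p) v) ->
  continuous f (w t) -> continuous g (w t) ->
  0 < sg * Im (f (w t)) -> 0 < sg * Im (g (w t)) ->
  exists eta, 0 < eta /\
    (forall y, t < y < t + eta -> 0 < sg * (Im (w y) - Im (w t))) /\
    (forall y, t - eta < y < t -> sg * (Im (w y) - Im (w t)) < 0).
Proof.
intros Hsol Hsg HF Cf Cg Hf Hg.
set (m := Rmin (sg * Im (f (w t))) (sg * Im (g (w t))) / 2).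
assert (Hm : 0 < m /\ m < sg * Im (f (w t)) /\ m < sg * Im (g (w t))).
{ unfold m, Rmin. destruct Rle_dec; lra. }
destruct Hm as [Hm [Hmf Hmg]].
destruct (solution_rate F w t 0 sg m Hsol) as [eta [He H]].
{ assert (Lf : locally (w t) (fun p => m < sg * Im (f p))).
  { apply (locally_gt (fun p => sg * Im (f p))); [|assumption].
    apply continuous_Rmult; [apply continuous_const|].
    apply (continuous_comp f Im); [assumption|apply continuous_Im]. }
  assert (Lg : locally (w t) (fun p => m < sg * Im (g p))).
  { apply (locally_gt (fun p => sg * Im (g p))); [|assumption].
    apply continuous_Rmult; [apply continuous_const|].
    apply (continuous_comp g Im); [assumption|apply continuous_Im]. }
  generalize (filter_and _ _ HF (filter_and _ _ Lf Lg)). apply filter_imp.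
  intros p [Hp [Hpf Hpg]] v Hv.
  enough (m <= sg * Im v) by lra.
  destruct (Hp v Hv) as [->|[->|Hs]]; [lra|lra|].
  apply (segment_Im _ _ _ m sg Hs); lra. }
exists eta; split; [assumption|]. split; intros y Hy.
- specialize (H t y ltac:(lra) ltac:(lra) ltac:(lra)). nra.
- specialize (H y t ltac:(lra) ltac:(lra) ltac:(lra)). nra.
Qed.

Lemma cross_upper w t sg :
  solution F w -> sg ^ 2 = 1 -> Im (w t) = 1 ->
  0 < sg * (Re (w t) + x1) -> 0 < sg * Re (w t) ->
  exists eta, 0 < eta /\
    (forall y, t < y < t + eta -> 0 < sg * (Im (w y) - 1)) /\
    (forall y, t - eta < y < t -> sg * (Im (w y) - 1) < 0).
Proof.
intros Hsol Hsg Ht H1 H2.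
destruct (cross_rate w t f_up f_ce sg) as [eta He]; try assumption.
(* On this neighbourhood the lower line is out of reach, so only [f_up] and [f_ce] contribute. *)
- generalize (locally_gt Im (w t) 0 (continuous_Im _) ltac:(lra)). apply filter_imp.
  intros p Hp v [_ HF].
  destruct HF as [[_ ->]|[[_ HF]|[[_ ->]|[[H _]|[H _]]]]]; try tauto; lra.
- apply f_up_continuous.
- apply f_ce_continuous. nra.
- rewrite Im_up, Ht. nra.
- rewrite Im_ce, <- Rmult_assoc. apply Rmult_lt_0_compat; [assumption|].
  apply Rinv_0_lt_compat. rewrite Ht. nra.
- rewrite Ht in He. exists eta. exact He.
Qed.

Lemma cross_lower w t sg :
  solution F w -> sg ^ 2 = 1 -> Im (w t) = -1 ->
  0 < sg * (Re (w t) - x0) -> 0 < sg * Re (w t) ->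
  exists eta, 0 < eta /\
    (forall y, t < y < t + eta -> 0 < sg * (Im (w y) - -1)) /\
    (forall y, t - eta < y < t -> sg * (Im (w y) - -1) < 0).
Proof.
intros Hsol Hsg Ht H1 H2.
destruct (cross_rate w t f_ce f_dn sg) as [eta He]; try assumption.
- generalize (locally_lt Im (w t) 0 (continuous_Im _) ltac:(lra)). apply filter_imp.
  intros p Hp v [_ HF].
  destruct HF as [[H _]|[[H _]|[[_ ->]|[[_ HF]|[_ ->]]]]]; try tauto; lra.
- apply f_ce_continuous. nra.
- apply f_dn_continuous.
- rewrite Im_ce, <- Rmult_assoc. apply Rmult_lt_0_compat; [assumption|].
  apply Rinv_0_lt_compat. rewrite Ht. nra.
- rewrite Im_dn, Ht. nra.
- rewrite Ht in He. exists eta. exact He.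
Qed.

Lemma solution_stays w t (P : C -> Prop) :
  solution F w -> locally (w t) P ->
  exists eta, 0 < eta /\ forall y, t - eta < y < t + eta -> P (w y).
Proof.
intros Hsol HP.
destruct (locally_interval t _ (solution_continuous F w t Hsol _ HP)) as [eta [He H]].
exists eta; split; [assumption|]. intros y Hy. apply H, Rabs_def1; lra.
Qed.

(** Inside a region openness suffices; on a line the crossing sign sends the solution to the correct
    side. For [Lf] and [Rt] openness must also keep it away from the imaginary axis and from the
    opposite line. *)
Lemma solution_after w t k :
  solution F w -> after k (w t) ->
  exists eta, 0 < eta /\ forall y, t < y < t + eta -> region k (w y).
Proof.
intros Hsol Hk.
destruct (classic (region k (w t))) as [Hr|Hr].
{ destruct (solution_stays w t (region k) Hsol (open_region k _ Hr)) as [eta [He H]].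
  exists eta; split; [assumption|]. intros y Hy. apply H; lra. }
destruct k; simpl in *.
- destruct (cross_upper w t 1) as [eta [He [H _]]]; try assumption; try lra.
  exists eta; split; [assumption|]. intros y Hy. specialize (H y Hy); lra.
- destruct (cross_upper w t (-1)) as [eta [He [H _]]]; try assumption; try lra.
  destruct (solution_stays w t (fun z => Re z < 0 /\ -1 < Im z) Hsol) as [e [He' H']].
  { apply filter_and; [apply locally_lt; [apply continuous_Re|lra]
                      |apply locally_gt; [apply continuous_Im|lra]]. }
  exists (Rmin eta e); split; [apply Rmin_glb_lt; assumption|].
  pose proof (Rmin_l eta e); pose proof (Rmin_r eta e). intros y Hy.
  specialize (H y ltac:(lra)). specialize (H' y ltac:(lra)). lra.
- destruct (cross_lower w t (-1)) as [eta [He [H _]]]; try assumption; try lra.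
  exists eta; split; [assumption|]. intros y Hy. specialize (H y Hy); lra.
- destruct (cross_lower w t 1) as [eta [He [H _]]]; try assumption; try lra.
  destruct (solution_stays w t (fun z => 0 < Re z /\ Im z < 1) Hsol) as [e [He' H']].
  { apply filter_and; [apply locally_gt; [apply continuous_Re|lra]
                      |apply locally_lt; [apply continuous_Im|lra]]. }
  exists (Rmin eta e); split; [apply Rmin_glb_lt; assumption|].
  pose proof (Rmin_l eta e); pose proof (Rmin_r eta e). intros y Hy.
  specialize (H y ltac:(lra)). specialize (H' y ltac:(lra)). lra.
Qed.

Lemma solution_before w t k :
  solution F w -> before k (w t) ->
  exists eta, 0 < eta /\ forall y, t - eta < y < t -> region k (w y).
Proof.
intros Hsol Hk.
destruct (classic (region k (w t))) as [Hr|Hr].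
{ destruct (solution_stays w t (region k) Hsol (open_region k _ Hr)) as [eta [He H]].
  exists eta; split; [assumption|]. intros y Hy. apply H; lra. }
destruct k; simpl in *.
- destruct (cross_upper w t (-1)) as [eta [He [_ H]]]; try assumption; try lra.
  exists eta; split; [assumption|]. intros y Hy. specialize (H y Hy); lra.
- destruct (cross_lower w t (-1)) as [eta [He [_ H]]]; try assumption; try lra.
  destruct (solution_stays w t (fun z => Re z < 0 /\ Im z < 1) Hsol) as [e [He' H']].
  { apply filter_and; [apply locally_lt; [apply continuous_Re|lra]
                      |apply locally_lt; [apply continuous_Im|lra]]. }
  exists (Rmin eta e); split; [apply Rmin_glb_lt; assumption|].
  pose proof (Rmin_l eta e); pose proof (Rmin_r eta e). intros y Hy.
  specialize (H y ltac:(lra)). specialize (H' y ltac:(lra)). lra.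
- destruct (cross_lower w t 1) as [eta [He [_ H]]]; try assumption; try lra.
  exists eta; split; [assumption|]. intros y Hy. specialize (H y Hy); lra.
- destruct (cross_upper w t 1) as [eta [He [_ H]]]; try assumption; try lra.
  destruct (solution_stays w t (fun z => 0 < Re z /\ -1 < Im z) Hsol) as [e [He' H']].
  { apply filter_and; [apply locally_gt; [apply continuous_Re|lra]
                      |apply locally_gt; [apply continuous_Im|lra]]. }
  exists (Rmin eta e); split; [apply Rmin_glb_lt; assumption|].
  pose proof (Rmin_l eta e); pose proof (Rmin_r eta e). intros y Hy.
  specialize (H y ltac:(lra)). specialize (H' y ltac:(lra)). lra.
Qed.

(** * Deviation from the cycle *)

(** Contraction of the distance to the focus over a half-turn, which takes time [PI / b] at rate
    [a]; likewise for [gamma]. *)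
Definition alpha : R := exp (a / b * PI).
Definition gamma : R := exp (c / d * PI).

(* [(X, 1)] is the fixed point of the return map on the line [Im z = 1], and
   [(- Y, 1)] the other point of that line on the cycle. *)
Definition X : R := (x0 + gamma * (x0 + x1 + alpha * x1)) / (1 - gamma * alpha).
Definition Y : R := x1 + alpha * (X + x1).

Lemma alpha_bounds : 0 < alpha < 1.
Proof. apply exp_neg_pos; assumption. Qed.

Lemma gamma_bounds : 0 < gamma < 1.
Proof. apply exp_neg_pos; assumption. Qed.

(** The definition of [Y] is the half-turn about [-x1 + i], this equation the one about [x0 - i].
    The strip adds nothing: it preserves [Re z ^ 2 - Im z ^ 2], hence [|Re z|] from one line to the
    other. The return map has slope [gamma * alpha], whence the denominator of [X]. *)
Lemma X_fixed : X = x0 + gamma * (x0 + Y).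
Proof.
pose proof alpha_bounds; pose proof gamma_bounds. unfold Y, X. field. nra.
Qed.

(** With [Y_gt], this places the four corners of the cycle in the crossing parts of the lines, and
    makes [X] and [Y] exceed 1 as the hyperbola lemmas require. *)
Lemma X_gt : x0 < X.
Proof.
pose proof alpha_bounds as Ha. pose proof gamma_bounds as Hg. unfold X.
assert (Hga : 0 < gamma * alpha < 1) by nra.
assert (0 < alpha * x1) by nra.
assert (0 < gamma * (x0 + x1 + alpha * x1)) by nra.
apply Rmult_lt_reg_r with (1 - gamma * alpha); [lra|].
unfold Rdiv. rewrite Rmult_assoc, Rinv_l by lra. nra.
Qed.

Lemma Y_gt : x1 < Y.
Proof. pose proof alpha_bounds; pose proof X_gt. unfold Y. nra. Qed.

(** The case [Dn] uses coordinates turned by [PI] about the focus [x0 - i]: the lower half-plane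
    becomes the upper one, where [angle] is defined, and the linear field keeps its form. *)
Definition deviation_on (k : side) (z : C) : R :=
  match k with
  | Up => spiral a b (X + x1) (Re z + x1) (Im z - 1)
  | Lf => sqrt (Re z ^ 2 - Im z ^ 2 + 1) - Y
  | Dn => spiral c d (x0 + Y) (x0 - Re z) (-1 - Im z)
  | Rt => sqrt (Re z ^ 2 - Im z ^ 2 + 1) - X
  end.

(* Measured along the rays from the foci in the half-planes; in the strip, where the
   orbit of [z] meets [Im = 1] or [Im = -1]. *)
Definition deviation (z : C) : R :=
  if Rlt_dec 1 (Im z) then deviation_on Up z
  else if Rlt_dec (Im z) (-1) then deviation_on Dn z
  else if Rlt_dec 0 (Re z) then deviation_on Rt z
  else deviation_on Lf z.

(** The region with its boundary points in the annulus, at entry and at exit alike, so that a single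
    formula covers a whole passage. *)
Definition side_closure (k : side) (z : C) : Prop :=
  match k with
  | Up => 1 < Im z \/ (Im z = 1 /\ (0 < Re z \/ Re z < - x1))
  | Lf => Re z < 0 /\ -1 <= Im z <= 1 /\ (Im z = 1 -> Re z < - x1)
  | Dn => Im z < -1 \/ (Im z = -1 /\ (Re z < 0 \/ x0 < Re z))
  | Rt => 0 < Re z /\ -1 <= Im z <= 1 /\ (Im z = -1 -> x0 < Re z)
  end.

Lemma after_side_closure k z : after k z -> side_closure k z.
Proof. destruct k; simpl; lra. Qed.

Lemma before_side_closure k z : before k z -> side_closure k z.
Proof. destruct k; simpl; lra. Qed.

Lemma region_side_closure k z : region k z -> side_closure k z.
Proof. destruct k; simpl; lra. Qed.

(** Two formulas compete on four rays. Where a half-plane is entered they agree by the choice of the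
    reference radii [X + x1] and [x0 + Y]; where it is left, agreement is the definition of [Y]
    above and [X_fixed] below. *)
Lemma deviation_side_closure k z : side_closure k z -> deviation z = deviation_on k z.
Proof.
intros Hk.
assert (Hup : forall z, Im z = 1 -> 0 < Re z -> deviation_on Up z = deviation_on Rt z).
{ intros p H1 H2. unfold deviation_on. rewrite H1. replace (1 - 1) with 0 by ring.
  rewrite spiral_pos_axis by lra. replace (Re p ^ 2 - 1 ^ 2 + 1) with (Re p ^ 2) by ring.
  rewrite sqrt_pow2 by lra. ring. }
assert (Hul : forall z, Im z = 1 -> Re z < - x1 -> deviation_on Up z = deviation_on Lf z).
{ intros p H1 H2. unfold deviation_on. rewrite H1. replace (1 - 1) with 0 by ring.
  rewrite spiral_neg_axis by lra. replace (Re p ^ 2 - 1 ^ 2 + 1) with ((- Re p) ^ 2) by ring.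
  rewrite sqrt_pow2 by lra. unfold Y, alpha. ring. }
assert (Hdn : forall z, Im z = -1 -> Re z < 0 -> deviation_on Dn z = deviation_on Lf z).
{ intros p H1 H2. unfold deviation_on. rewrite H1. replace (-1 - -1) with 0 by ring.
  rewrite spiral_pos_axis by lra. replace (Re p ^ 2 - (-1) ^ 2 + 1) with ((- Re p) ^ 2) by ring.
  rewrite sqrt_pow2 by lra. ring. }
assert (Hdr : forall z, Im z = -1 -> x0 < Re z -> deviation_on Dn z = deviation_on Rt z).
{ intros p H1 H2. unfold deviation_on. rewrite H1. replace (-1 - -1) with 0 by ring.
  rewrite spiral_neg_axis by lra. replace (Re p ^ 2 - (-1) ^ 2 + 1) with (Re p ^ 2) by ring.
  rewrite sqrt_pow2 by lra. pose proof X_fixed as HX. unfold gamma in HX. lra. }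
unfold deviation. destruct k; simpl in Hk.
- destruct (Rlt_dec 1 (Im z)); [reflexivity|]. destruct (Rlt_dec (Im z) (-1)); [lra|].
  destruct (Rlt_dec 0 (Re z)); symmetry; [apply Hup|apply Hul]; lra.
- destruct (Rlt_dec 1 (Im z)); [lra|]. destruct (Rlt_dec (Im z) (-1)); [lra|].
  destruct (Rlt_dec 0 (Re z)); [lra|reflexivity].
- destruct (Rlt_dec 1 (Im z)); [lra|]. destruct (Rlt_dec (Im z) (-1)); [reflexivity|].
  destruct (Rlt_dec 0 (Re z)); symmetry; [apply Hdr|apply Hdn]; lra.
- destruct (Rlt_dec 1 (Im z)); [lra|]. destruct (Rlt_dec (Im z) (-1)); [lra|].
  destruct (Rlt_dec 0 (Re z)); [reflexivity|lra].
Qed.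

Lemma deviation_on_continuous k z : side_closure k z -> continuous (deviation_on k) z.
Proof.
intros H.
assert (Hce : continuous (fun z : C => sqrt (Re z ^ 2 - Im z ^ 2 + 1)) z).
{ apply (continuous_comp (fun z : C => Re z ^ 2 - Im z ^ 2 + 1) sqrt); [cont|apply continuous_sqrt]. }
destruct k; simpl in H; unfold deviation_on.
- apply (spiral_continuous a b (X + x1) (fun z : C => Re z + x1) (fun z : C => Im z - 1));
    [lra|lra| |]; cont.
- apply continuous_Rminus; [exact Hce|apply continuous_const].
- apply (spiral_continuous c d (x0 + Y) (fun z : C => x0 - Re z) (fun z : C => -1 - Im z));
    [lra|lra| |]; cont.
- apply continuous_Rminus; [exact Hce|apply continuous_const].
Qed.

Definition rate (k : side) : R :=
  match k with Up => a | Dn => c | _ => 0 end.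

Lemma center_derive (w : R -> C) t :
  is_derive (V := C_R_NormedModule) w t (f_ce (w t)) ->
  is_derive (fun s => Re (w s) ^ 2 - Im (w s) ^ 2) t 0 /\
  (Re (w t) <> 0 -> is_derive (fun s => Re (w s) * Im (w s)) t 1).
Proof.
intros H. pose proof (is_derive_Re _ _ _ H) as HR. pose proof (is_derive_Im _ _ _ H) as HI.
rewrite Re_ce in HR. rewrite Im_ce in HI. split.
- evar_last; [apply @is_derive_minus; apply is_derive_pow; eassumption|].
  unfold minus, plus, opp; simpl. ring.
- intros Hz. evar_last; [apply (is_derive_mult (K := R_AbsRing)); [eassumption|eassumption|]|].
  + intros; apply Rmult_comm.
  + unfold plus, mult; simpl. field. nra.
Qed.

Lemma deviation_on_derive (w : R -> C) t k :
  is_derive (V := C_R_NormedModule) w t (field k (w t)) -> region k (w t) ->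
  is_derive (fun s => deviation_on k (w s)) t (rate k * deviation_on k (w t)).
Proof.
intros H Hk.
assert (Hce : forall m, field k = f_ce -> -1 < Im (w t) < 1 ->
  is_derive (fun s => sqrt (Re (w s) ^ 2 - Im (w s) ^ 2 + 1) - m) t 0).
{ intros m Hf Hi. rewrite Hf in H. destruct (center_derive w t H) as [H1 _].
  assert (H2 : is_derive (fun s => Re (w s) ^ 2 - Im (w s) ^ 2 + 1) t 0).
  { evar_last; [apply @is_derive_plus; [exact H1|apply @is_derive_const]|]. apply Rplus_0_r. }
  evar_last.
  - apply @is_derive_minus; [|apply @is_derive_const].
    apply (is_derive_sqrt _ _ _ H2). nra.
  - unfold minus, plus, opp, zero; simpl. unfold Rdiv; ring. }
pose proof (is_derive_Re _ _ _ H) as HR. pose proof (is_derive_Im _ _ _ H) as HI.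
destruct k; cbn [field region rate deviation_on] in *.
- rewrite Re_up in HR. rewrite Im_up in HI.
  apply (spiral_derive a b (X + x1) (fun s => Re (w s) + x1) (fun s => Im (w s) - 1)); [lra|lra| |].
  + evar_last; [apply @is_derive_plus; [exact HR|apply @is_derive_const]|]. apply Rplus_0_r.
  + evar_last; [apply @is_derive_minus; [exact HI|apply @is_derive_const]|].
    unfold minus, plus, opp, zero; simpl. ring.
- rewrite Rmult_0_l. apply Hce; [reflexivity|tauto].
- rewrite Re_dn in HR. rewrite Im_dn in HI.
  apply (spiral_derive c d (x0 + Y) (fun s => x0 - Re (w s)) (fun s => -1 - Im (w s))); [lra|lra| |].
  + evar_last; [apply @is_derive_minus; [apply @is_derive_const|exact HR]|].
    unfold minus, plus, opp, zero; simpl. ring.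
  + evar_last; [apply @is_derive_minus; [apply @is_derive_const|exact HI]|].
    unfold minus, plus, opp, zero; simpl. ring.
- rewrite Rmult_0_l. apply Hce; [reflexivity|tauto].
Qed.

(** * Decay of the squared deviation, and uniqueness of solutions in the annulus *)

Lemma piece_after w t :
  solution F w -> annulus (w t) ->
  exists k eta, 0 < eta /\ after k (w t) /\ forall y, t < y < t + eta -> region k (w y).
Proof.
intros Hsol Ha. destruct (annulus_after _ Ha) as [k Hk].
destruct (solution_after w t k Hsol Hk) as [eta [He H]]. exists k, eta; tauto.
Qed.

Lemma piece_before w t :
  solution F w -> annulus (w t) ->
  exists k eta, 0 < eta /\ before k (w t) /\ forall y, t - eta < y < t -> region k (w y).
Proof.
intros Hsol Ha. destruct (annulus_before _ Ha) as [k Hk].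
destruct (solution_before w t k Hsol Hk) as [eta [He H]]. exists k, eta; tauto.
Qed.

Lemma deviation_sq_piece w k x y :
  solution F w -> x <= y -> (forall s, x <= s <= y -> side_closure k (w s)) ->
  (forall s, x < s < y -> region k (w s)) ->
  deviation (w y) ^ 2 <= deviation (w x) ^ 2.
Proof.
intros Hsol Hxy Hc Hr.
rewrite (deviation_side_closure k (w y)), (deviation_side_closure k (w x)) by (apply Hc; lra).
apply (nonincreasing_of_derive (fun s => deviation_on k (w s) ^ 2) x y Hxy).
- intros s Hs. apply continuous_sqr.
  apply (continuous_comp w (deviation_on k)); [apply (solution_continuous F), Hsol|].
  apply deviation_on_continuous, Hc, Hs.
- intros s Hs. specialize (Hr s Hs). exists (2 * rate k * deviation_on k (w s) ^ 2). split.
  + evar_last; [apply is_derive_pow, deviation_on_derive, Hr; apply solution_region; assumption|].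
    simpl. ring.
  + assert (rate k <= 0) by (destruct k; simpl; lra). nra.
Qed.

(** Around any instant the solution spends a short time in one region before and in one region
    after, the instant itself lying in both closures. Local comparison therefore suffices, and
    crossings need not be counted. *)
Lemma deviation_sq_nonincreasing w s t :
  solution F w -> (forall t, annulus (w t)) -> s <= t ->
  deviation (w t) ^ 2 <= deviation (w s) ^ 2.
Proof.
intros Hsol Ha Hst.
apply (local_monotone (fun t => deviation (w t) ^ 2)); [|exact Hst]. intros x.
destruct (piece_after w x Hsol (Ha x)) as [k [e [He [Hk H]]]].
destruct (piece_before w x Hsol (Ha x)) as [k' [e' [He' [Hk' H']]]].
exists (Rmin e e'). split; [apply Rmin_glb_lt; assumption|].
pose proof (Rmin_l e e'); pose proof (Rmin_r e e'). split; intros y Hy.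
- apply (deviation_sq_piece w k); [assumption|lra| |intros; apply H; lra].
  intros q Hq. destruct (Req_dec q x) as [->|]; [apply after_side_closure, Hk|].
  apply region_side_closure, H. lra.
- apply (deviation_sq_piece w k'); [assumption|lra| |intros; apply H'; lra].
  intros q Hq. destruct (Req_dec q x) as [->|]; [apply before_side_closure, Hk'|].
  apply region_side_closure, H'. lra.
Qed.

(** A periodic nonincreasing quantity is constant, so at a time spent in a half-plane the derivative
    [2 * rate k * L^2] vanishes while [rate k] does not. *)
Lemma deviation_zero w T :
  solution F w -> (forall t, annulus (w t)) -> 0 < T -> (forall t, w (t + T) = w t) ->
  forall t, deviation (w t) = 0.
Proof.
intros Hsol Ha HT Hp.
assert (Hconst : forall s t, deviation (w s) ^ 2 = deviation (w t) ^ 2).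
{ apply (periodic_nonincreasing (fun t => deviation (w t) ^ 2) T HT).
  - intros t. now rewrite Hp.
  - intros s t. apply deviation_sq_nonincreasing; assumption. }
assert (Hzero : forall t k, region k (w t) -> rate k <> 0 -> forall s, deviation (w s) = 0).
{ intros t k Hk Hrk s.
  assert (Hd : is_derive (fun s => deviation (w s) ^ 2) t (2 * rate k * deviation_on k (w t) ^ 2)).
  { apply (is_derive_ext_loc (fun s => deviation_on k (w s) ^ 2)).
    - destruct (solution_stays w t (region k) Hsol (open_region k _ Hk)) as [eta [He H]].
      exists (mkposreal eta He). intros y Hy. change (Rabs (y - t) < eta) in Hy.
      apply Rabs_def2 in Hy.
      rewrite (deviation_side_closure k); [reflexivity|].
      apply region_side_closure, H. lra.
    - evar_last; [apply is_derive_pow, deviation_on_derive, Hk; apply solution_region; assumption|].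
      simpl. ring. }
  apply constant_is_derive in Hd; [|intros; apply Hconst].
  rewrite <- (deviation_side_closure k) in Hd by apply region_side_closure, Hk.
  assert (H0 : deviation (w s) ^ 2 = 0) by (rewrite (Hconst s t); nra). nra. }
destruct (classic (exists t k, region k (w t) /\ rate k <> 0)) as [[t [k [Hk Hr]]]|Hn].
{ exact (Hzero t k Hk Hr). }
exfalso.
(* The remaining solution never enters a half-plane. Then [- (Re * Im)] would be nonincreasing and
   periodic, hence constant, although its derivative is [-1] off the lines. *)
assert (Hk : forall t k, region k (w t) -> is_derive (fun s => - (Re (w s) * Im (w s))) t (-1)).
{ intros t k Hk.
  assert (Hf : field k = f_ce /\ Re (w t) <> 0).
  { destruct k; simpl in *; try (split; [reflexivity|lra]); exfalso; apply Hn.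
    - exists t, Up; simpl; split; [assumption|lra].
    - exists t, Dn; simpl; split; [assumption|lra]. }
  pose proof (solution_region w t k Hsol Hk) as Hd. rewrite (proj1 Hf) in Hd.
  destruct (center_derive w t Hd) as [_ H2].
  evar_last; [apply @is_derive_opp, H2, Hf|]. reflexivity. }
assert (Hcont : forall t, continuous (fun s => - (Re (w s) * Im (w s))) t).
{ intros t. apply (continuous_opp (V := R_NormedModule)).
  assert (Hw := solution_continuous F w t Hsol).
  apply continuous_Rmult; [apply (continuous_comp w Re)|apply (continuous_comp w Im)]; cont. }
assert (Hq : forall s t, - (Re (w s) * Im (w s)) = - (Re (w t) * Im (w t))).
{ apply (periodic_nonincreasing (fun t => - (Re (w t) * Im (w t))) T HT).
  - intros t. now rewrite Hp.
  - apply local_monotone. intros x.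
    destruct (piece_after w x Hsol (Ha x)) as [k [e [He [_ H]]]].
    destruct (piece_before w x Hsol (Ha x)) as [k' [e' [He' [_ H']]]].
    exists (Rmin e e'). split; [apply Rmin_glb_lt; assumption|].
    pose proof (Rmin_l e e'); pose proof (Rmin_r e e'). split; intros y Hy.
    + apply (nonincreasing_of_derive (fun t => - (Re (w t) * Im (w t)))); [lra|intros; apply Hcont|].
      intros s Hs. exists (-1); split; [|lra]. apply (Hk s k), H. lra.
    + apply (nonincreasing_of_derive (fun t => - (Re (w t) * Im (w t)))); [lra|intros; apply Hcont|].
      intros s Hs. exists (-1); split; [|lra]. apply (Hk s k'), H'. lra. }
destruct (piece_after w 0 Hsol (Ha 0)) as [k [e [He [_ H]]]].
specialize (H (e / 2) ltac:(lra)).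
pose proof (constant_is_derive _ _ _ (fun s => Hq s (e / 2)) (Hk _ _ H)). lra.
Qed.

(** In a half-plane the difference of two solutions obeys the linear equation with real part
    [e <= 0], so its norm cannot grow from zero. In the strip the squares [z^2] keep a constant
    difference, and the sign of the real part recovers [z]. The initial point may lie on a line:
    only continuity is used there. *)
Lemma piece_unique (w1 w2 : R -> C) k x y :
  x < y -> (forall s, continuous w1 s) -> (forall s, continuous w2 s) ->
  (forall s, x < s <= y -> region k (w1 s) /\ is_derive (V := C_R_NormedModule) w1 s (field k (w1 s))) ->
  (forall s, x < s <= y -> region k (w2 s) /\ is_derive (V := C_R_NormedModule) w2 s (field k (w2 s))) ->
  w1 x = w2 x -> w1 y = w2 y.
Proof.
intros Hxy C1 C2 D1 D2 Hx.
assert (CR : forall w s, continuous (w : R -> C) s -> continuous (fun s => Re (w s)) s).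
{ intros w s H. apply (continuous_comp w Re); cont. }
assert (CI : forall w s, continuous (w : R -> C) s -> continuous (fun s => Im (w s)) s).
{ intros w s H. apply (continuous_comp w Im); cont. }
assert (Heq : Re (w1 y) = Re (w2 y) /\ Im (w1 y) = Im (w2 y)).
2:{ destruct Heq as [ER EI]. destruct (w1 y), (w2 y). simpl in *. congruence. }
assert (Hfocus : forall e f, e <= 0 ->
  (forall s, x < s < y ->
    is_derive (fun s => Re (w1 s) - Re (w2 s)) s
      (e * (Re (w1 s) - Re (w2 s)) - f * (Im (w1 s) - Im (w2 s))) /\
    is_derive (fun s => Im (w1 s) - Im (w2 s)) s
      (f * (Re (w1 s) - Re (w2 s)) + e * (Im (w1 s) - Im (w2 s)))) ->
  Re (w1 y) = Re (w2 y) /\ Im (w1 y) = Im (w2 y)).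
{ intros e f He HD.
  assert (Hn : (Re (w1 y) - Re (w2 y)) ^ 2 + (Im (w1 y) - Im (w2 y)) ^ 2
            <= (Re (w1 x) - Re (w2 x)) ^ 2 + (Im (w1 x) - Im (w2 x)) ^ 2).
  { apply (nonincreasing_of_derive
      (fun s => (Re (w1 s) - Re (w2 s)) ^ 2 + (Im (w1 s) - Im (w2 s)) ^ 2)); [lra| |].
    - intros s _. apply continuous_Rplus; apply continuous_sqr, continuous_Rminus; auto.
    - intros s Hs. destruct (HD s Hs) as [HR HI].
      exists (2 * e * ((Re (w1 s) - Re (w2 s)) ^ 2 + (Im (w1 s) - Im (w2 s)) ^ 2)). split.
      2:{ pose proof (pow2_ge_0 (Re (w1 s) - Re (w2 s))).
          pose proof (pow2_ge_0 (Im (w1 s) - Im (w2 s))). nra. }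
      evar_last; [apply @is_derive_plus; apply is_derive_pow; eassumption|].
      unfold plus; simpl. ring. }
  rewrite Hx in Hn. replace (Re (w2 x) - Re (w2 x)) with 0 in Hn by ring.
  replace (Im (w2 x) - Im (w2 x)) with 0 in Hn by ring.
  rewrite <- !Rsqr_pow2, Rsqr_0 in Hn.
  destruct (Rplus_sqr_eq_0 (Re (w1 y) - Re (w2 y)) (Im (w1 y) - Im (w2 y))); [|lra].
  pose proof (Rle_0_sqr (Re (w1 y) - Re (w2 y))).
  pose proof (Rle_0_sqr (Im (w1 y) - Im (w2 y))). lra. }
assert (Hcenter : (forall z, region k z -> field k z = f_ce z /\ Re z <> 0) ->
  0 < Re (w1 y) * Re (w2 y) -> Re (w1 y) = Re (w2 y) /\ Im (w1 y) = Im (w2 y)).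
{ intros Hk Hs.
  assert (HD : forall w, (forall s, x < s <= y ->
      region k (w s) /\ is_derive (V := C_R_NormedModule) w s (field k (w s))) ->
    forall s, x < s < y -> is_derive (fun s => Re (w s) ^ 2 - Im (w s) ^ 2) s 0 /\
      is_derive (fun s => Re (w s) * Im (w s)) s 1).
  { intros w D s Hs'. destruct (D s ltac:(lra)) as [Hr Hd].
    destruct (Hk _ Hr) as [E Hz]. rewrite E in Hd.
    destruct (center_derive w s Hd) as [H1 H2]. split; [exact H1|exact (H2 Hz)]. }
  apply square_root_unique; [assumption| |].
  - assert (E := constant_of_derive
      (fun s => (Re (w1 s) ^ 2 - Im (w1 s) ^ 2) - (Re (w2 s) ^ 2 - Im (w2 s) ^ 2)) x y ltac:(lra)).
    simpl in E. rewrite Hx in E. apply Rminus_diag_uniq.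
    transitivity (Re (w2 x) ^ 2 - Im (w2 x) ^ 2 - (Re (w2 x) ^ 2 - Im (w2 x) ^ 2)); [|ring].
    apply E.
    + intros s _. apply continuous_Rminus; apply continuous_Rminus; apply continuous_sqr; auto.
    + intros s Hs'. destruct (HD w1 D1 s Hs') as [P1 Q1]. destruct (HD w2 D2 s Hs') as [P2 Q2].
      evar_last; [exact (is_derive_minus _ _ _ _ _ P1 P2)|].
      unfold minus, plus, opp; simpl. ring.
  - assert (E := constant_of_derive
      (fun s => Re (w1 s) * Im (w1 s) - Re (w2 s) * Im (w2 s)) x y ltac:(lra)).
    simpl in E. rewrite Hx in E. apply Rminus_diag_uniq.
    transitivity (Re (w2 x) * Im (w2 x) - Re (w2 x) * Im (w2 x)); [|ring].
    apply E.
    + intros s _. apply continuous_Rminus; apply continuous_Rmult; auto.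
    + intros s Hs'. destruct (HD w1 D1 s Hs') as [P1 Q1]. destruct (HD w2 D2 s Hs') as [P2 Q2].
      evar_last; [exact (is_derive_minus _ _ _ _ _ Q1 Q2)|].
      unfold minus, plus, opp; simpl. ring. }
assert (R1 := proj1 (D1 y ltac:(lra))). assert (R2 := proj1 (D2 y ltac:(lra))).
destruct k; cbn [field region] in *.
- apply (Hfocus a b); [lra|]. intros s Hs.
  destruct (D1 s ltac:(lra)) as [_ E1]. destruct (D2 s ltac:(lra)) as [_ E2].
  split; (evar_last;
    [first [exact (is_derive_minus _ _ _ _ _ (is_derive_Re _ _ _ E1) (is_derive_Re _ _ _ E2))
           |exact (is_derive_minus _ _ _ _ _ (is_derive_Im _ _ _ E1) (is_derive_Im _ _ _ E2))]|]);
    rewrite ?Re_up, ?Im_up; unfold minus, plus, opp; simpl; ring.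
- apply Hcenter; [|nra]. intros z Hz. split; [reflexivity|lra].
- apply (Hfocus c d); [lra|]. intros s Hs.
  destruct (D1 s ltac:(lra)) as [_ E1]. destruct (D2 s ltac:(lra)) as [_ E2].
  split; (evar_last;
    [first [exact (is_derive_minus _ _ _ _ _ (is_derive_Re _ _ _ E1) (is_derive_Re _ _ _ E2))
           |exact (is_derive_minus _ _ _ _ _ (is_derive_Im _ _ _ E1) (is_derive_Im _ _ _ E2))]|]);
    rewrite ?Re_dn, ?Im_dn; unfold minus, plus, opp; simpl; ring.
- apply Hcenter; [|nra]. intros z Hz. split; [reflexivity|lra].
Qed.

(** [after k] depends on the position alone, so from a common point both solutions enter the same
    region, where [piece_unique] applies; limits of agreement times are handled by continuity. *)
Lemma forward_unique w1 w2 tau :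
  solution F w1 -> solution F w2 ->
  (forall t, annulus (w1 t)) -> (forall t, annulus (w2 t)) -> w1 0 = w2 tau ->
  forall t, 0 <= t -> w1 t = w2 (tau + t).
Proof.
intros S1 S2 A1 A2 H0 t Ht.
assert (C1 : forall s, continuous w1 s) by (intros; apply (solution_continuous F), S1).
assert (C2 : forall s, continuous (fun r => w2 (tau + r)) s)
  by (intros; apply shift_continuous, (solution_continuous F), S2).
apply (real_induction (fun t => w1 t = w2 (tau + t)) 0 t Ht).
- rewrite Rplus_0_r. exact H0.
- intros x Hx E.
  destruct (annulus_after _ (A1 x)) as [k Hk].
  destruct (solution_after w1 x k S1 Hk) as [e1 [He1 H1]]. rewrite E in Hk.
  destruct (solution_after w2 (tau + x) k S2 Hk) as [e2 [He2 H2]].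
  exists (Rmin e1 e2). split; [apply Rmin_glb_lt; assumption|].
  pose proof (Rmin_l e1 e2); pose proof (Rmin_r e1 e2). intros y Hy _.
  destruct (Req_dec x y) as [<-|]; [exact E|].
  apply (piece_unique w1 (fun r => w2 (tau + r)) k x y); try assumption; [lra| |].
  + intros s Hs. assert (Hr : region k (w1 s)) by (apply H1; lra).
    split; [exact Hr|]. apply solution_region; assumption.
  + intros s Hs. assert (Hr : region k (w2 (tau + s))) by (apply H2; lra).
    split; [exact Hr|]. apply shift_derive, solution_region; assumption.
- intros x Hx IH.
  assert (HC : continuous (fun s => (Re (w1 s) - Re (w2 (tau + s))) ^ 2
                                  + (Im (w1 s) - Im (w2 (tau + s))) ^ 2) x).
  { apply continuous_Rplus; apply continuous_sqr, continuous_Rminus.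
    - apply (continuous_comp w1 Re); cont. apply C1.
    - apply (continuous_comp (fun r => w2 (tau + r)) Re); cont. apply C2.
    - apply (continuous_comp w1 Im); cont. apply C1.
    - apply (continuous_comp (fun r => w2 (tau + r)) Im); cont. apply C2. }
  destruct (Req_dec ((Re (w1 x) - Re (w2 (tau + x))) ^ 2
                    + (Im (w1 x) - Im (w2 (tau + x))) ^ 2) 0) as [Hz|Hz].
  + destruct (w1 x) as [p q], (w2 (tau + x)) as [r s]. unfold Re, Im in Hz. cbn [fst snd] in Hz.
    rewrite <- !Rsqr_pow2 in Hz. apply Rplus_sqr_eq_0 in Hz.
    replace p with r by lra. replace q with s by lra. reflexivity.
  + exfalso.
    assert (Hpos : 0 < (Re (w1 x) - Re (w2 (tau + x))) ^ 2 + (Im (w1 x) - Im (w2 (tau + x))) ^ 2).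
    { pose proof (pow2_ge_0 (Re (w1 x) - Re (w2 (tau + x)))).
      pose proof (pow2_ge_0 (Im (w1 x) - Im (w2 (tau + x)))). lra. }
    assert (HL := locally_gt _ x 0 HC Hpos).
    destruct (locally_interval x _ HL) as [eta [He H]].
    set (y := Rmax 0 (x - eta / 2)).
    assert (0 <= y < x /\ x - eta < y) as [Hy1 Hy2].
    { unfold y, Rmax; destruct Rle_dec; lra. }
    specialize (H y ltac:(apply Rabs_def1; lra)). simpl in H. rewrite (IH y Hy1) in H. lra.
Qed.

(** * The cycle *)

(** Each arc starts at its entry corner at time 0, whence the shift of the hyperbola parameter,
    which is [-m] there. [Lf] uses the invariance of [i / z] under [z -> -z], and [Dn] a half-turn
    about its focus. *)
Definition arc (k : side) (s : R) : C :=
  match k with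
  | Up => (rot_re a b (X + x1) s - x1, 1 + rot_im a b (X + x1) s)
  | Lf => (- hyp_re Y (s - Y), - hyp_im Y (s - Y))
  | Dn => (x0 - rot_re c d (x0 + Y) s, -1 - rot_im c d (x0 + Y) s)
  | Rt => (hyp_re X (s - X), hyp_im X (s - X))
  end.

(** A half-turn at angular speed [b] or [d]; in the strip, the time for [Re z * Im z] to run at unit
    speed from [-m] to [m], with [m] equal to [Y] or [X]. *)
Definition dur (k : side) : R :=
  match k with Up => PI / b | Lf => 2 * Y | Dn => PI / d | Rt => 2 * X end.

Definition next (k : side) : side :=
  match k with Up => Lf | Lf => Dn | Dn => Rt | Rt => Up end.

Lemma dur_pos k : 0 < dur k.
Proof.
pose proof X_gt; pose proof Y_gt. pose proof PI_RGT_0.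
destruct k; simpl; try lra; apply Rdiv_lt_0_compat; assumption.
Qed.

Definition corner (k : side) : C :=
  match k with Up => (X, 1) | Lf => (- Y, 1) | Dn => (- Y, -1) | Rt => (X, -1) end.

Lemma arc_start k : arc k 0 = corner k.
Proof.
pose proof X_gt; pose proof Y_gt.
destruct k; simpl; unfold rot_re, rot_im.
- rewrite !Rmult_0_r, exp_0, cos_0, sin_0. f_equal; ring.
- destruct (hyp_unique Y Y (-1)) as [E1 E2]; try lra.
  replace (0 - Y) with (Y * -1) by ring. rewrite E1, E2. f_equal; ring.
- rewrite !Rmult_0_r, exp_0, cos_0, sin_0. f_equal; ring.
- destruct (hyp_unique X X (-1)) as [E1 E2]; try lra.
  replace (0 - X) with (X * -1) by ring. rewrite E1, E2. f_equal; ring.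
Qed.

Lemma arc_end k : arc k (dur k) = corner (next k).
Proof.
pose proof X_gt; pose proof Y_gt.
destruct k; simpl; unfold rot_re, rot_im.
- replace (a * (PI / b)) with (a / b * PI) by (field; lra). fold alpha.
  replace (b * (PI / b)) with PI by (field; lra). rewrite cos_PI, sin_PI.
  f_equal; unfold Y; ring.
- destruct (hyp_unique Y Y 1) as [E1 E2]; try lra.
  replace (2 * Y - Y) with (Y * 1) by ring. rewrite E1, E2. reflexivity.
- replace (c * (PI / d)) with (c / d * PI) by (field; lra). fold gamma.
  replace (d * (PI / d)) with PI by (field; lra). rewrite cos_PI, sin_PI.
  f_equal; [pose proof X_fixed; lra|ring].
- destruct (hyp_unique X X 1) as [E1 E2]; try lra.
  replace (2 * X - X) with (X * 1) by ring. rewrite E1, E2. reflexivity.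
Qed.

Lemma arc_region k s : 0 < s < dur k -> region k (arc k s).
Proof.
pose proof X_gt; pose proof Y_gt.
assert (Hsin : forall f, 0 < f -> 0 < s < PI / f -> 0 < sin (f * s)).
{ intros f Hf Hs. apply sin_gt_0; [nra|].
  apply Rmult_lt_reg_r with (/ f); [apply Rinv_0_lt_compat, Hf|].
  replace (f * s * / f) with s by (field; lra). apply Hs. }
destruct k; simpl; intros Hs; unfold Re, Im; simpl.
- unfold rot_im. specialize (Hsin b b_pos Hs). pose proof (exp_pos (a * s)).
  assert (0 < (X + x1) * exp (a * s)) by nra. nra.
- destruct (hyp_spec Y (s - Y)) as [H1 _]; [lra|].
  pose proof (hyp_im_bound Y (s - Y)). lra.
- unfold rot_im. specialize (Hsin d d_pos Hs). pose proof (exp_pos (c * s)).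
  assert (0 < (x0 + Y) * exp (c * s)) by nra. nra.
- destruct (hyp_spec X (s - X)) as [H1 _]; [lra|].
  pose proof (hyp_im_bound X (s - X)). lra.
Qed.

Lemma arc_derive k s : is_derive (V := C_R_NormedModule) (arc k) s (field k (arc k s)).
Proof.
pose proof X_gt; pose proof Y_gt.
assert (Dm : forall m, is_derive (fun s => s - m) s 1).
{ intros m. evar_last; [apply @is_derive_minus; [apply @is_derive_id|apply @is_derive_const]|].
  unfold minus, plus, opp, one, zero; simpl. ring. }
assert (Hh : forall m, 1 < m ->
  is_derive (fun s => hyp_re m (s - m)) s
    (hyp_im m (s - m) * / (hyp_re m (s - m) ^ 2 + hyp_im m (s - m) ^ 2)) /\
  is_derive (fun s => hyp_im m (s - m)) s
    (hyp_re m (s - m) * / (hyp_re m (s - m) ^ 2 + hyp_im m (s - m) ^ 2))).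
{ intros m Hm. destruct (hyp_derive m (s - m) Hm) as [H1 H2].
  split; (evar_last; [apply (is_derive_comp _ (fun s => s - m)); [eassumption|apply Dm]|];
    apply Rmult_1_l). }
destruct k; apply is_derive_pair; unfold field;
  rewrite ?Re_up, ?Im_up, ?Re_dn, ?Im_dn, ?Re_ce, ?Im_ce; unfold arc, Re, Im; cbn [fst snd].
- destruct (rot_derive a b (X + x1) s) as [H1 H2].
  evar_last; [apply @is_derive_minus; [exact H1|apply @is_derive_const]|].
  unfold minus, plus, opp, zero; simpl. ring.
- destruct (rot_derive a b (X + x1) s) as [H1 H2].
  evar_last; [apply @is_derive_plus; [apply @is_derive_const|exact H2]|].
  unfold plus, zero; simpl. ring.
- destruct (Hh Y) as [H1 H2]; [lra|]. destruct (hyp_spec Y (s - Y)) as [Hp _]; [lra|].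
  evar_last; [apply @is_derive_opp, H1|]. unfold opp; simpl. field. nra.
- destruct (Hh Y) as [H1 H2]; [lra|]. destruct (hyp_spec Y (s - Y)) as [Hp _]; [lra|].
  evar_last; [apply @is_derive_opp, H2|]. unfold opp; simpl. field. nra.
- destruct (rot_derive c d (x0 + Y) s) as [H1 H2].
  evar_last; [apply @is_derive_minus; [apply @is_derive_const|exact H1]|].
  unfold minus, plus, opp, zero; simpl. ring.
- destruct (rot_derive c d (x0 + Y) s) as [H1 H2].
  evar_last; [apply @is_derive_minus; [apply @is_derive_const|exact H2]|].
  unfold minus, plus, opp, zero; simpl. ring.
- apply (Hh X). lra.
- apply (Hh X). lra.
Qed.

Lemma arc_annulus k s : 0 <= s <= dur k -> annulus (arc k s).
Proof.
pose proof X_gt; pose proof Y_gt.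
intros Hs. destruct (Req_dec s 0) as [->|Hs0].
{ rewrite arc_start. destruct k; unfold annulus, Re, Im; simpl; lra. }
destruct (Req_dec s (dur k)) as [->|Hs1].
{ rewrite arc_end. destruct k; unfold annulus, Re, Im; simpl; lra. }
assert (Hr : region k (arc k s)) by (apply arc_region; lra).
revert Hr. generalize (arc k s). intros z Hr. destruct k; unfold annulus; simpl in Hr; lra.
Qed.

(** The time is read off the point: polar angle over angular speed on a spiral, the product of the
    coordinates shifted by [m] on a hyperbola. This turns vanishing deviation into membership in the
    cycle. *)
Lemma arc_covers k z :
  side_closure k z -> deviation_on k z = 0 -> exists s, 0 <= s <= dur k /\ arc k s = z.
Proof.
pose proof X_gt as HX; pose proof Y_gt as HY. intros Hk Hd.
assert (Hspiral : forall e f r u v, 0 < f -> 0 <= v -> u <> 0 \/ 0 < v -> spiral e f r u v = 0 ->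
  exists s, 0 <= s <= PI / f /\ rot_re e f r s = u /\ rot_im e f r s = v).
{ intros e f r u v Hf Hv Huv H0. exists (angle u v / f).
  pose proof (angle_range u v Hv Huv) as Hang. destruct (cos_sin_angle u v Hv Huv) as [E1 E2].
  unfold spiral in H0.
  split.
  - assert (0 < / f) by (apply Rinv_0_lt_compat, Hf). unfold Rdiv. split; [nra|].
    apply Rmult_le_compat_r; lra.
  - unfold rot_re, rot_im. replace (e * (angle u v / f)) with (e / f * angle u v) by (field; lra).
    replace (f * (angle u v / f)) with (angle u v) by (field; lra).
    replace (r * exp (e / f * angle u v)) with (sqrt (u ^ 2 + v ^ 2)) by lra. tauto. }
assert (Hhyp : forall m x y, 1 < m -> 0 < x -> -1 <= y <= 1 -> sqrt (x ^ 2 - y ^ 2 + 1) = m ->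
  exists s, 0 <= s <= 2 * m /\ hyp_re m (s - m) = x /\ hyp_im m (s - m) = y).
{ intros m x y Hm Hx Hy Hs. exists (x * y + m).
  assert (Hm2 : x ^ 2 - y ^ 2 + 1 = m ^ 2).
  { rewrite <- Hs, <- (Rsqr_pow2 (sqrt _)), Rsqr_sqrt by nra. reflexivity. }
  replace (x * y + m - m) with (x * y) by ring.
  split; [|apply hyp_unique; lra].
  assert ((x * y) ^ 2 <= m ^ 2).
  2:{ rewrite <- !Rsqr_pow2 in H. apply Rsqr_le_abs_0 in H. rewrite (Rabs_pos_eq m) in H by lra.
      apply Rabs_le_between in H. lra. }
  assert (Hy2 : 0 <= y ^ 2 <= 1) by nra.
  (* The second factor is [x ^ 2], so this says [x^2 y^2 <= x^2], while [x^2 <= m^2] because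
     [y^2 <= 1]. *)
  assert (0 <= (1 - y ^ 2) * (m ^ 2 - 1 + y ^ 2)) by (apply Rmult_le_pos; nra).
  rewrite Rpow_mult_distr. replace (x ^ 2) with (m ^ 2 - 1 + y ^ 2) by lra. lra. }
destruct k; simpl in Hk; unfold deviation_on in Hd; unfold arc, dur.
- destruct (Hspiral a b (X + x1) (Re z + x1) (Im z - 1)) as [s [Hs [E1 E2]]]; try lra.
  exists s. split; [assumption|]. rewrite E1, E2. rewrite (surjective_pairing z).
  unfold Re, Im; simpl. f_equal; ring.
- destruct (Hhyp Y (- Re z) (- Im z)) as [s [Hs [E1 E2]]]; try lra.
  { replace ((- Re z) ^ 2 - (- Im z) ^ 2 + 1) with (Re z ^ 2 - Im z ^ 2 + 1) by ring. lra. }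
  exists s. split; [assumption|]. rewrite E1, E2. rewrite (surjective_pairing z).
  unfold Re, Im; simpl. f_equal; ring.
- destruct (Hspiral c d (x0 + Y) (x0 - Re z) (-1 - Im z)) as [s [Hs [E1 E2]]]; try lra.
  exists s. split; [assumption|]. rewrite E1, E2. rewrite (surjective_pairing z).
  unfold Re, Im; simpl. f_equal; ring.
- destruct (Hhyp X (Re z) (Im z)) as [s [Hs [E1 E2]]]; try lra.
  exists s. split; [assumption|]. rewrite E1, E2. rewrite (surjective_pairing z). reflexivity.
Qed.

(** * Gluing the arcs into a periodic curve *)

Definition offset (k : side) : R :=
  match k with
  | Up => 0
  | Lf => dur Up
  | Dn => dur Up + dur Lf
  | Rt => dur Up + dur Lf + dur Dn
  end.

Definition period : R := dur Up + dur Lf + dur Dn + dur Rt.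

Lemma period_pos : 0 < period.
Proof.
pose proof (dur_pos Up); pose proof (dur_pos Lf); pose proof (dur_pos Dn); pose proof (dur_pos Rt).
unfold period. lra.
Qed.

Definition cycle_base (s : R) : C :=
  if Rlt_dec s (offset Lf) then arc Up s
  else if Rlt_dec s (offset Dn) then arc Lf (s - offset Lf)
  else if Rlt_dec s (offset Rt) then arc Dn (s - offset Dn)
  else arc Rt (s - offset Rt).

Definition cycle (t : R) : C := cycle_base (t - IZR (Int_part (t / period)) * period).

Lemma cycle_piece_open k n s :
  0 <= s < dur k -> cycle (IZR n * period + offset k + s) = arc k s.
Proof.
intros Hs. pose proof period_pos as HT.
pose proof (dur_pos Up) as HU; pose proof (dur_pos Lf) as HL;
pose proof (dur_pos Dn) as HD; pose proof (dur_pos Rt) as HR.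
assert (Ho : 0 <= offset k + s < period).
{ unfold period. destruct k; cbn [offset]; lra. }
unfold cycle.
replace (Int_part ((IZR n * period + offset k + s) / period)) with n.
2:{ apply Int_part_spec.
    replace ((IZR n * period + offset k + s) / period) with (IZR n + (offset k + s) / period)
      by (field; lra).
    assert (0 <= (offset k + s) / period < 1); [|lra].
    assert (0 < / period) by (apply Rinv_0_lt_compat, HT). unfold Rdiv. split; [nra|].
    apply Rmult_lt_reg_r with period; [assumption|]. rewrite Rmult_assoc, Rinv_l by lra. lra. }
replace (IZR n * period + offset k + s - IZR n * period) with (offset k + s) by ring.
unfold cycle_base. destruct k; cbn [offset] in *;
  repeat (destruct Rlt_dec; try lra); f_equal; ring.
Qed.

(** At [s = dur k] the definition of [cycle] has already switched to the next arc, which starts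
    where this one ends. Including this endpoint gives access to left neighbourhoods of crossing
    times. *)
Lemma cycle_piece k n s :
  0 <= s <= dur k -> cycle (IZR n * period + offset k + s) = arc k s.
Proof.
intros Hs. destruct (Req_dec s (dur k)) as [->|Hne]; [|apply cycle_piece_open; lra].
rewrite arc_end, <- arc_start. pose proof (dur_pos (next k)).
(* The end of [Rt] belongs to the next period, hence [n + 1] in that case. *)
assert (E : exists m, IZR n * period + offset k + dur k = IZR m * period + offset (next k) + 0).
{ destruct k; cbn [next offset]; try (exists n; lra).
  exists (n + 1)%Z. rewrite plus_IZR. unfold period. lra. }
destruct E as [m ->]. apply cycle_piece_open. lra.
Qed.

Lemma cycle_cover t : exists k n s, 0 <= s < dur k /\ t = IZR n * period + offset k + s.
Proof.
pose proof period_pos as HT.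
destruct (base_Int_part (t / period)) as [H1 H2]. set (n := Int_part (t / period)) in *.
set (q := t - IZR n * period).
assert (Hq : 0 <= q < period).
{ assert (E : t = t / period * period) by (field; lra).
  unfold q. rewrite E. split; nra. }
assert (Ht : t = IZR n * period + q) by (unfold q; ring).
pose proof (dur_pos Up) as HU; pose proof (dur_pos Lf) as HL;
pose proof (dur_pos Dn) as HD; pose proof (dur_pos Rt) as HR. unfold period in Hq.
destruct (Rlt_or_le q (offset Lf)) as [h|h]; cbn [offset] in h;
  [exists Up, n, q; cbn [offset]; lra|].
destruct (Rlt_or_le q (offset Dn)) as [h2|h2]; cbn [offset] in h2;
  [exists Lf, n, (q - offset Lf); cbn [offset]; lra|].
destruct (Rlt_or_le q (offset Rt)) as [h3|h3]; cbn [offset] in h3;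
  [exists Dn, n, (q - offset Dn)|exists Rt, n, (q - offset Rt)]; cbn [offset]; lra.
Qed.

Lemma cycle_cover_left t : exists k n s, 0 < s <= dur k /\ t = IZR n * period + offset k + s.
Proof.
destruct (cycle_cover t) as [k [n [s [Hs ->]]]].
destruct (Req_dec s 0) as [->|Hne]; [|exists k, n, s; lra].
pose proof (dur_pos Up) as HU; pose proof (dur_pos Lf) as HL;
pose proof (dur_pos Dn) as HD; pose proof (dur_pos Rt) as HR.
destruct k; cbn [offset].
- exists Rt, (n - 1)%Z, (dur Rt). rewrite minus_IZR. unfold period. cbn [offset]. lra.
- exists Up, n, (dur Up). cbn [offset]. lra.
- exists Lf, n, (dur Lf). cbn [offset]. lra.
- exists Dn, n, (dur Dn). cbn [offset]. lra.
Qed.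

Lemma cycle_periodic t : cycle (t + period) = cycle t.
Proof.
destruct (cycle_cover t) as [k [n [s [Hs ->]]]].
replace (IZR n * period + offset k + s + period) with (IZR (n + 1) * period + offset k + s)
  by (rewrite plus_IZR; ring).
rewrite !cycle_piece_open by assumption. reflexivity.
Qed.

Lemma cycle_annulus t : annulus (cycle t).
Proof.
destruct (cycle_cover t) as [k [n [s [Hs ->]]]]. rewrite cycle_piece_open by assumption.
apply arc_annulus. lra.
Qed.

Lemma annulus_nonzero z : annulus z -> z <> RtoC 0.
Proof. intros H ->. unfold annulus, Re, Im in H. simpl in H. lra. Qed.

Lemma F_nonempty z : z <> RtoC 0 -> exists w, F z w.
Proof.
intros Hz.
assert (Hs : forall p q, segment p q q).
{ intros p q. exists 0. split; [lra|]. replace (1 - 0) with 1 by ring. ring. }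
destruct (Rtotal_order (Im z) 1) as [H1|[H1|H1]].
- destruct (Rtotal_order (Im z) (-1)) as [H2|[H2|H2]].
  + exists (f_dn z). split; [assumption|]. tauto.
  + exists (f_dn z). split; [assumption|]. do 3 right. left. split; [assumption|apply Hs].
  + exists (f_ce z). split; [assumption|]. do 2 right. left. split; [apply Rabs_def1; lra|reflexivity].
- exists (f_ce z). split; [assumption|]. right. left. split; [assumption|apply Hs].
- exists (f_up z). split; [assumption|]. left. split; [assumption|reflexivity].
Qed.

Lemma region_F k z : z <> RtoC 0 -> region k z -> F z (field k z).
Proof.
intros Hz Hk. split; [assumption|].
destruct k; simpl in *; try tauto; right; right; left; split; try apply Rabs_def1; tauto.
Qed.

(** [f_ce] is unbounded near the origin, but the strip arcs have nonzero real part, so the velocity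
    is continuous on a compact time interval. *)
Lemma arc_slope k : exists M, forall s, 0 <= s <= dur k ->
  Rabs (Re (field k (arc k s))) <= M /\ Rabs (Im (field k (arc k s))) <= M.
Proof.
assert (Hre : forall s, (k = Lf \/ k = Rt) -> Re (arc k s) <> 0).
{ pose proof X_gt as HX; pose proof Y_gt as HY. intros s [-> | ->]; unfold Re; simpl.
  - destruct (hyp_spec Y (s - Y)); lra.
  - destruct (hyp_spec X (s - X)); lra. }
assert (Hc : forall s, continuous (fun s => field k (arc k s)) s).
{ intros s. apply (continuous_comp (arc k) (field k)).
  - apply (ex_derive_continuous (V := C_R_NormedModule)). eexists. apply arc_derive.
  - destruct k; [apply f_up_continuous|apply f_ce_continuous, Hre; tauto
      |apply f_dn_continuous|apply f_ce_continuous, Hre; tauto]. }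
destruct (bounded_continuity (V := C_R_NormedModule) (fun s => field k (arc k s)) 0 (dur k)
  (fun s _ => Hc s)) as [M HM].
exists M. intros s Hs. specialize (HM s Hs).
assert (Hn : forall z : C, Rabs (Re z) <= norm (V := C_R_NormedModule) z /\
  Rabs (Im z) <= norm (V := C_R_NormedModule) z).
{ intros z. destruct (norm_prod (K := R_AbsRing) (U := R_NormedModule) (V := R_NormedModule)
    (Re z) (Im z)) as [HN _].
  split; (eapply Rle_trans; [|eapply Rle_trans; [exact HN|right; destruct z; reflexivity]]);
  [apply Rmax_l|apply Rmax_r]. }
destruct (Hn (field k (arc k s))). split; lra.
Qed.

Lemma cycle_lipschitz : exists M, forall s t, s <= t -> Cmod (cycle t - cycle s)%C <= M * (t - s).
Proof.
assert (HM : exists M, forall k s, 0 <= s <= dur k ->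
  Rabs (Re (field k (arc k s))) <= M /\ Rabs (Im (field k (arc k s))) <= M).
{ destruct (arc_slope Up) as [M1 H1]. destruct (arc_slope Lf) as [M2 H2].
  destruct (arc_slope Dn) as [M3 H3]. destruct (arc_slope Rt) as [M4 H4].
  exists (Rmax (Rmax M1 M2) (Rmax M3 M4)).
  pose proof (Rmax_l M1 M2); pose proof (Rmax_r M1 M2); pose proof (Rmax_l M3 M4);
  pose proof (Rmax_r M3 M4); pose proof (Rmax_l (Rmax M1 M2) (Rmax M3 M4));
  pose proof (Rmax_r (Rmax M1 M2) (Rmax M3 M4)).
  intros k s Hs. destruct k;
    [destruct (H1 s Hs)|destruct (H2 s Hs)|destruct (H3 s Hs)|destruct (H4 s Hs)]; split; lra. }
destruct HM as [M HM].
(* The two equations single out the forms [Re], [- Re], [Im] and [- Im]; [local_monotone] then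
   passes the speed bound [M] through the corners. *)
assert (Hmono : forall al be, al ^ 2 + be ^ 2 = 1 -> al * be = 0 -> forall s t, s <= t ->
  al * Re (cycle t) + be * Im (cycle t) - M * t <= al * Re (cycle s) + be * Im (cycle s) - M * s).
{ intros al be H1 H0. apply (local_monotone (fun t => al * Re (cycle t) + be * Im (cycle t) - M * t)).
  assert (Harc : forall k n x y, 0 <= x -> x <= y -> y <= dur k ->
    let t s := IZR n * period + offset k + s in
    al * Re (cycle (t y)) + be * Im (cycle (t y)) - M * t y
      <= al * Re (cycle (t x)) + be * Im (cycle (t x)) - M * t x).
  { intros k n x y Hx Hxy Hy t. unfold t. rewrite !cycle_piece by lra.
    assert (Hd : forall s, is_derive (fun s => al * Re (arc k s) + be * Im (arc k s) - M * s) s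
      (al * Re (field k (arc k s)) + be * Im (field k (arc k s)) - M)).
    { intros s. pose proof (is_derive_Re _ _ _ (arc_derive k s)) as DR.
      pose proof (is_derive_Im _ _ _ (arc_derive k s)) as DI.
      evar_last.
      - apply @is_derive_minus; [apply @is_derive_plus; apply is_derive_scal; eassumption|].
        apply is_derive_scal, @is_derive_id.
      - unfold minus, plus, opp, one; simpl. ring. }
    enough (al * Re (arc k y) + be * Im (arc k y) - M * y
      <= al * Re (arc k x) + be * Im (arc k x) - M * x) by lra.
    apply (nonincreasing_of_derive (fun s => al * Re (arc k s) + be * Im (arc k s) - M * s)); [assumption| |].
    - intros s _. apply (ex_derive_continuous (V := R_NormedModule)). eexists. apply Hd.
    - intros s Hs. eexists. split; [apply Hd|]. destruct (HM k s) as [B1 B2]; [lra|].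
      apply Rabs_le_between in B1. apply Rabs_le_between in B2.
      apply Rmult_integral in H0. destruct H0 as [-> | ->].
      + assert (be = 1 \/ be = -1) as [-> | ->]; [|lra|lra].
        destruct (Rle_or_lt 0 be); [left|right]; nra.
      + assert (al = 1 \/ al = -1) as [-> | ->]; [|lra|lra].
        destruct (Rle_or_lt 0 al); [left|right]; nra. }
  intros t.
  destruct (cycle_cover t) as [k [n [s [Hs Ht]]]].
  destruct (cycle_cover_left t) as [k' [n' [s' [Hs' Ht']]]].
  exists (Rmin (dur k - s) s'). split; [apply Rmin_glb_lt; lra|].
  pose proof (Rmin_l (dur k - s) s'); pose proof (Rmin_r (dur k - s) s'). split; intros y Hy.
  - specialize (Harc k n s (y - t + s) ltac:(lra) ltac:(lra) ltac:(lra)). cbv beta zeta in Harc.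
    rewrite <- Ht in Harc.
    replace (IZR n * period + offset k + (y - t + s)) with y in Harc by lra. exact Harc.
  - specialize (Harc k' n' (y - t + s') s' ltac:(lra) ltac:(lra) ltac:(lra)). cbv beta zeta in Harc.
    rewrite <- Ht' in Harc.
    replace (IZR n' * period + offset k' + (y - t + s')) with y in Harc by lra. exact Harc. }
exists (2 * M). intros s t Hst.
pose proof (Hmono 1 0 ltac:(ring) ltac:(ring) s t Hst).
pose proof (Hmono (-1) 0 ltac:(ring) ltac:(ring) s t Hst).
pose proof (Hmono 0 1 ltac:(ring) ltac:(ring) s t Hst).
pose proof (Hmono 0 (-1) ltac:(ring) ltac:(ring) s t Hst).
assert (HR : Rabs (Re (cycle t - cycle s)%C) <= M * (t - s)).
{ replace (Re (cycle t - cycle s)%C) with (Re (cycle t) - Re (cycle s)) by (unfold Re; simpl; ring).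
  apply Rabs_le. lra. }
assert (HI : Rabs (Im (cycle t - cycle s)%C) <= M * (t - s)).
{ replace (Im (cycle t - cycle s)%C) with (Im (cycle t) - Im (cycle s)) by (unfold Im; simpl; ring).
  apply Rabs_le. lra. }
set (z := (cycle t - cycle s)%C) in *.
unfold Cmod. change (fst z) with (Re z). change (snd z) with (Im z).
pose proof (Rabs_pos (Re z)); pose proof (Rabs_pos (Im z)).
apply Rle_trans with (sqrt ((2 * M * (t - s)) ^ 2)); [|rewrite sqrt_pow2; lra].
apply sqrt_le_1_alt. rewrite <- (pow2_abs (Re z)), <- (pow2_abs (Im z)). nra.
Qed.

Lemma crossing_times_null :
  null_set (fun t => exists k n, t = IZR n * period + offset k).
Proof.
set (side_of := fun j : nat => match j with 0%nat => Up | 1%nat => Lf | 2%nat => Dn | _ => Rt end).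
(* An integer is coded as a difference of two naturals, and [j] codes the side; the enumeration has
   repetitions, which a null set tolerates. *)
set (e := fun m : nat =>
  let (p, r) := Cantor.of_nat m in let (q, j) := Cantor.of_nat r in
  (INR p - INR q) * period + offset (side_of j)).
apply (countable_null_set _ e). intros t [k [n ->]].
assert (Hj : exists j, side_of j = k).
{ destruct k; [exists 0%nat|exists 1%nat|exists 2%nat|exists 3%nat]; reflexivity. }
destruct Hj as [j <-].
exists (Cantor.to_nat (Z.to_nat n, Cantor.to_nat (Z.to_nat (- n), j))).
unfold e. rewrite !Cantor.cancel_of_to, !INR_IZR_INZ.
replace (IZR n) with (IZR (Z.of_nat (Z.to_nat n)) - IZR (Z.of_nat (Z.to_nat (- n)))); [reflexivity|].
rewrite <- minus_IZR. f_equal. lia.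
Qed.

Lemma cycle_solution : solution F cycle.
Proof.
split; [|split].
- intros t. apply F_nonempty, annulus_nonzero, cycle_annulus.
- intros s t _. destruct cycle_lipschitz as [M HM].
  apply (lipschitz_absolutely_continuous cycle M), HM.
- intros eps He. destruct (crossing_times_null eps He) as [u [v [H1 [H2 H3]]]].
  exists u, v; repeat split; try assumption. intros t Ht. apply H3. apply NNPP. intros Hn. apply Ht.
  destruct (cycle_cover t) as [k [n [s [Hs Et]]]].
  assert (Hs0 : 0 < s).
  { destruct (Req_dec s 0) as [->|]; [|lra]. exfalso. apply Hn. exists k, n. lra. }
  assert (Hr : region k (cycle t)) by (rewrite Et, cycle_piece_open by assumption; apply arc_region; lra).
  exists (field k (cycle t)). split; [|apply region_F; [apply annulus_nonzero, cycle_annulus|exact Hr]].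
  (* Off the crossing times the cycle coincides near [t] with one arc shifted in time. *)
  apply (is_derive_ext_loc (V := C_R_NormedModule)
    (fun r => arc k (- (IZR n * period + offset k) + r))).
  + assert (Hm : 0 < Rmin s (dur k - s)) by (apply Rmin_glb_lt; lra).
    exists (mkposreal _ Hm). intros y Hy. change (Rabs (y - t) < Rmin s (dur k - s)) in Hy.
    pose proof (Rmin_l s (dur k - s)); pose proof (Rmin_r s (dur k - s)).
    apply Rabs_def2 in Hy.
    rewrite <- (cycle_piece_open k n) by lra. f_equal. ring.
  + apply shift_derive.
    replace (- (IZR n * period + offset k) + t) with s by lra.
    rewrite Et, cycle_piece_open by assumption. apply arc_derive.
Qed.

Lemma cycle_limit_cycle : limit_cycle F (fun p => exists t, cycle t = p).
Proof.
pose proof period_pos as HT. split.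
- exists cycle, period. split; [apply cycle_solution|]. split; [exact HT|].
  split; [apply cycle_periodic|]. split; [|tauto].
  exists (IZR 0 * period + offset Up + 0), (IZR 0 * period + offset Rt + 0).
  pose proof (dur_pos Up); pose proof (dur_pos Rt).
  rewrite !cycle_piece_open, !arc_start by lra. intros E. injection E. lra.
(* The whole annulus serves as neighbourhood, so isolation is proved in a strong, global form. *)
- exists annulus. split; [apply open_annulus|]. split.
  { intros p [t <-]. apply cycle_annulus. }
  intros G' [w [T [Hw [HT' [Hper [_ HG]]]]]] HU.
  assert (Ha : forall t, annulus (w t)) by (intros t; apply HU, HG; exists t; reflexivity).
  assert (Hin : forall t, exists s, cycle s = w t).
  { intros t. destruct (annulus_after _ (Ha t)) as [k Hk]. apply after_side_closure in Hk.
    pose proof (deviation_zero w T Hw Ha HT' Hper t) as H0.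
    rewrite (deviation_side_closure k) in H0 by exact Hk.
    destruct (arc_covers k (w t) Hk H0) as [s [Hs E]].
    exists (IZR 0 * period + offset k + s). rewrite cycle_piece by exact Hs. exact E. }
  intros p. rewrite HG. split.
  + intros [t <-]. apply Hin.
  (* The solution [w] starts on the cycle at phase [tau] and follows it from then on; the point of
     phase [s] is met again at some [s + INR n * period] not before [tau], so knowledge of the
     future is enough. *)
  + intros [s <-]. destruct (Hin 0) as [tau Htau].
    destruct (exists_period_above period s tau HT) as [n Hn].
    exists (s + INR n * period - tau).
    rewrite (forward_unique w cycle tau Hw cycle_solution Ha cycle_annulus (eq_sym Htau)) by lra.
    replace (tau + (s + INR n * period - tau)) with (s + INR n * period) by ring.
    apply periodic_nat, cycle_periodic.
Qed.

End System.

Theorem proposition6 (a b c d x0 x1 : R)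
  (a_nz : a <> 0%R) (b_nz : b <> 0%R) (c_nz : c <> 0%R) (d_nz : d <> 0%R)
  (x0_nz : x0 <> 0%R) (x1_nz : x1 <> 0%R)
  (a_neg : (a < 0)%R) (c_neg : (c < 0)%R)
  (b_pos : (0 < b)%R) (d_pos : (0 < d)%R)
  (x0_gt1 : (1 < x0)%R) (x1_gt1 : (1 < x1)%R) :
  exists G : C -> Prop,
    limit_cycle
      (filippov (fun z : C => z <> RtoC 0)
         (fun z : C => ((RtoC a + Ci * RtoC b) * (z - Ci + RtoC x1))%C)
         (fun z : C => (Ci / z)%C)
         (fun z : C => ((RtoC c + Ci * RtoC d) * (z + Ci - RtoC x0))%C))
      G.
Proof.
exists (fun p => exists t, cycle a b c d x0 x1 t = p).
apply cycle_limit_cycle; assumption.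
Qed.
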